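(* Let $\varpi$ be a weight function on $\Omega$ that admits Assertions 1--5 (see context). Let $\mathsf w$ be a doubling weight on $\Omega$. If $r>0$, $1\le p\le\infty$, $n=1,2,\dots$ and $f\in\Pi_n(\Omega)$, then $$\|(-\mathfrak D_\varpi)^{r/2}f\|_{p,\mathsf w}\le c\,n^r\,\|f\|_{p,\mathsf w},$$ where $c$ is independent of $f$ and $n$.
   Context: Setting. $\Omega$ is a domain in $\mathbb R^d$ (either a set with nonempty interior or an algebraic surface) with a metric $\mathsf d$; $B(x,r)=\{y\in\Omega:\mathsf d(x,y)<r\}$; $\mathsf m$ is the Lebesgue measure on $\Omega$, assumed doubling with respect to $\mathsf d$, with $\min_{x}\mathsf m(B(x,\varepsilon))\ge c_\varepsilon>0$ for each $\varepsilon>0$. A weight is a nonnegative integrable function $\mathsf w$, $\mathsf w(E)=\int_E\mathsf w\,\mathrm d\mathsf m$; it is a doubling weight if $\mathsf w(B(x,2r))\le L\,\mathsf w(B(x,r))$ for all $x\in\Omega$, $r>0$, with some constant $L$. $\|\cdot\|_{p,\mathsf w}$ is the norm of $L^p(\Omega,\mathsf w)$, the uniform norm for $p=\infty$. $\Pi_n(\Omega)$ is the space of polynomials of degree at most $n$ restricted to $\Omega$. $\varpi$ is a doubling weight with $\int_\Omega\varpi\,\mathrm d\mathsf m=1$; $\mathcal V_n(\Omega,\varpi)$ is the space of polynomials in $\Pi_n(\Omega)$ orthogonal to $\Pi_{n-1}(\Omega)$ for $\langle f,g\rangle_\varpi=\int_\Omega fg\varpi\,\mathrm d\mathsf m$;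 $P_n(\varpi;\cdot,\cdot)$ is its reproducing kernel and $\operatorname{proj}_n(\varpi;f)$ the orthogonal projection onto $\mathcal V_n(\Omega,\varpi)$. Standing assumptions on $\varpi$: (A) There is a second order derivation operator $\mathfrak D_\varpi$ with $\mathfrak D_\varpi Y=-\mu(n)Y$ for all $Y\in\mathcal V_n(\Omega,\varpi)$, $n\ge0$, where $\mu$ is a nonnegative quadratic polynomial; for $r>0$, $(-\mathfrak D_\varpi)^{r/2}$ is defined by $\operatorname{proj}_n(\varpi;(-\mathfrak D_\varpi)^{r/2}f)=\mu(n)^{r/2}\operatorname{proj}_n(\varpi;f)$. (B) Addition formula: for some $\alpha\ge\beta\ge-\frac12$, $P_n(\varpi;x,y)=\int_{[-1,1]^m}Z_n^{(\alpha,\beta)}(\xi(x,y;u))\,\mathrm d\tau(u)$ with $Z_n^{(\alpha,\beta)}(t)=P_n^{(\alpha,\beta)}(1)P_n^{(\alpha,\beta)}(t)/h_n^{(\alpha,\beta)}$, where $P_n^{(\alpha,\beta)}$ is the Jacobi polynomial, $h_n^{(\alpha,\beta)}$ its squared $L^2$ norm for the Jacobi weight $(1-t)^\alpha(1+t)^\beta$ normalized to unit integral on $[-1,1]$, $m$ is a positive integer, $\xi(x,y;u)\in[-1,1]$ is symmetric in $x,y$, and $\tau$ is a probability measure on $[-1,1]^m$ (possibly with finite support). A nonnegative $\widehat a\in C^\infty(\mathbb R)$ is an admissible cut-off function if either (a) $\operatorname{supp}\widehat a\subset[0,2]$ and $\widehat a(t)=1$ for $t\in[0,1]$ (as a function on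 $[0,\infty)$), or (b) $\operatorname{supp}\widehat a\subset[1/2,2]$. Put $L_n(\varpi;x,y)=\sum_{k\ge0}\widehat a(k/n)P_k(\varpi;x,y)$ and, for $r>0$, $L_n^{(r)}(\varpi;x,y)=\sum_{k\ge0}\widehat a(k/n)[\mu(k)]^{r/2}P_k(\varpi;x,y)$. The assertions are, for admissible $\widehat a$ and $n=1,2,\dots$, with constants independent of $n$ and of the points: Assertion 1: for every $\kappa>0$, $|L_n(\varpi;x,y)|\le c_\kappa\big[\varpi(B(x,n^{-1}))\varpi(B(y,n^{-1}))\big]^{-1/2}(1+n\,\mathsf d(x,y))^{-\kappa}$ for $x,y\in\Omega$. Assertion 2: for some $\delta_0<1$, for every $\kappa>0$, $0<\delta\le\delta_0$ and $x_1\in B(x_2,\frac{\delta}{n})$, $y\in\Omega$, $|L_n(\varpi;x_1,y)-L_n(\varpi;x_2,y)|\le c_\kappa\,n\,\mathsf d(x_1,x_2)\big[\varpi(B(x_1,n^{-1}))\varpi(B(x_2,n^{-1}))\big]^{-1/2}(1+n\,\mathsf d(x_2,y))^{-\kappa}$. Assertion 3: for sufficiently large $\kappa>0$, $\int_\Omega\frac{\varpi(y)}{\varpi(B(y,n^{-1}))(1+n\,\mathsf d(x,y))^\kappa}\,\mathrm d\mathsf m(y)\le c$ for $x\in\Omega$. Assertion 4: $\Omega$ is compact, and for each $n$ and each $x\in\Omega$ there is a nonnegative polynomial $T_x$ of degree at most $n$ such that (1) $T_x(x)=1$, $T_x(y)\ge\delta'>0$ for $y\in B(x,\frac1n)$ with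 $\delta'$ independent of $n$, and for each $\gamma>1$, $0\le T_x(y)\le c_\gamma(1+n\,\mathsf d(x,y))^{-\gamma}$ for $y\in\Omega$; (2) there is a polynomial $q_n$ such that $q_n(x)T_x(y)$ is a polynomial of degree at most $\rho n$ in the $x$-variable, for some positive integer $\rho$, and $c_1\le q_n(x)\le c_2$ for $x\in\Omega$ for some positive numbers $c_1,c_2$ (constants independent of $n$). Assertion 5: for every $r>0$ and $\kappa>0$, $|L_n^{(r)}(\varpi;x,y)|\le c_\kappa\,n^r\big[\varpi(B(x,n^{-1}))\varpi(B(y,n^{-1}))\big]^{-1/2}(1+n\,\mathsf d(x,y))^{-\kappa}$ for $x,y\in\Omega$. *)

(* Defs.v *)
From HB Require Import structures.
From mathcomp Require Import all_boot all_order all_algebra.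
From mathcomp Require Import all_classical all_reals all_analysis.
From mathcomp Require Import -(notations) mpoly.

Set Implicit Arguments.
Unset Strict Implicit.
Unset Printing Implicit Defensive.

Import Order.TTheory GRing.Theory Num.Theory.
Import numFieldNormedType.Exports.

Local Open Scope classical_set_scope.
Local Open Scope ring_scope.

(* R^d, equipped with its Borel sigma-algebra; convertible to 'rV[R]_d, which
   carries the topology. *)
Definition euclid (R : realType) (d : nat) :=
  g_sigma_algebraType (@open 'rV[R]_d).

Section EuclideanMeasures.
Context {R : realType} {d : nat}.
Implicit Types (x y a b : 'rV[R]_d) (A U : set 'rV[R]_d).

Definition box a b : set 'rV[R]_d :=
  [set x | forall i, a ord0 i < x ord0 i <= b ord0 i].

Definition box_volume a b : R :=
  \prod_(i < d) Num.max 0 (b ord0 i - a ord0 i).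

Definition lebesgue_outer A : \bar R :=
  ereal_inf [set (\sum_(0 <= j <oo) (box_volume (u j).1 (u j).2)%:E)%E
            | u in [set u : nat -> 'rV[R]_d * 'rV[R]_d |
                    A `<=` \bigcup_j box (u j).1 (u j).2]].

(* The library norm on 'rV[R]_d is the sup norm. *)
Definition eucl_dist x y : R :=
  Num.sqrt (\sum_(i < d) (x ord0 i - y ord0 i) ^+ 2).

Definition diam U : \bar R :=
  ereal_sup [set (eucl_dist z.1 z.2)%:E | z in U `*` U].

End EuclideanMeasures.

Definition unit_ball_volume (R : realType) (k : nat) : R :=
  fine (lebesgue_outer [set x : 'rV[R]_k | eucl_dist x 0 <= 1]).

(* Hausdorff measure, normalized so that it is the usual surface area on
   k-dimensional surfaces.  As diam set0 = -oo and fine -oo = 0, the empty set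
   has weight 0 when 0 < k, the only case in which this is used. *)
Definition hausdorff_pre (R : realType) (d k : nat) (delta : R)
    (A : set 'rV[R]_d) : \bar R :=
  ereal_inf [set (\sum_(0 <= j <oo)
                   (unit_ball_volume R k * (fine (diam (U j)) / 2) ^+ k)%:E)%E
            | U in [set U : nat -> set 'rV[R]_d |
                    (forall j, (diam (U j) <= delta%:E)%E) /\
                    A `<=` \bigcup_j U j]].

Definition hausdorff_outer (R : realType) (d k : nat)
    (A : set 'rV[R]_d) : \bar R :=
  ereal_sup [set hausdorff_pre k delta A | delta in [set delta : R | 0 < delta]].

Definition peval (R : realType) (d : nat) (p : mpoly d R)
    (x : euclid R d) : R :=
  meval (fun i => (x : 'rV[R]_d) ord0 i) p.

(* Only the restrictions of mdist to Omega x Omega and of leb to Omega matter. *)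
Record mdomain (R : realType) (d : nat) := MDomain {
  Omega : set (euclid R d);
  mdist : euclid R d -> euclid R d -> R;
  leb : {measure set (euclid R d) -> \bar R}
}.

Section Setting.
Context {R : realType} {d : nat} (X : mdomain R d).
Local Notation pt := (euclid R d).
Local Notation Om := (Omega X).
Local Notation m := (leb X).

Definition metric_on_Omega : Prop :=
  [/\ forall x y, Om x -> Om y -> 0 <= mdist X x y,
      forall x y, Om x -> Om y -> (mdist X x y = 0 <-> x = y),
      forall x y, Om x -> Om y -> mdist X x y = mdist X y x
    & forall x y z, Om x -> Om y -> Om z ->
        mdist X x z <= mdist X x y + mdist X y z].

Definition dball (x : pt) (r : R) : set pt := [set y | Om y /\ mdist X x y < r].

Definition full_dimensional : Prop :=
  interior (Om : set 'rV[R]_d) !=set0 /\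
  forall A : set pt, measurable A -> m A = lebesgue_outer (A `&` Om).

(* Omega may be a portion of a real algebraic variety, such as the bounded
   conic surface |x| = t, 0 <= t <= 1; leb is then its surface measure. *)
Definition algebraic_surface : Prop :=
  exists (k : nat) (p : mpoly d R),
    [/\ (0 < k < d)%N, p != 0,
        forall x, Om x -> peval p x = 0
      & forall A : set pt, measurable A -> m A = hausdorff_outer k (A `&` Om)].

Record is_domain : Prop := IsDomain {
  domain_shape : full_dimensional \/ algebraic_surface;
  domain_measurable : measurable Om;
  domain_metric : metric_on_Omega;
  domain_dball : forall x r, Om x -> 0 < r -> measurable (dball x r);
  domain_doubling : exists2 L : R, 0 < L & forall x r, Om x -> 0 < r ->
    (m (dball x (2 * r)) <= L%:E * m (dball x r))%E;
  domain_lower : forall e : R, 0 < e -> exists2 c : R, 0 < c &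
    forall x, Om x -> (c%:E <= m (dball x e))%E
}.

Definition wmass (w : pt -> R) (E : set pt) : R := \int[m]_(x in E) w x.

Definition weight (w : pt -> R) : Prop :=
  (forall x, Om x -> 0 <= w x) /\ m.-integrable Om (EFin \o w).

Definition doubling_weight (w : pt -> R) : Prop :=
  weight w /\
  exists L : R, forall x r, Om x -> 0 < r ->
    wmass w (dball x (2 * r)) <= L * wmass w (dball x r).

(* The exponent oo denotes the uniform norm, so this is not 'N[mu]_p[f]. *)
Definition wnorm (w : pt -> R) (p : \bar R) (f : pt -> R) : \bar R :=
  match p with
  | q%:E => ((\int[m]_(x in Om) (`|f x| `^ q * w x)%:E) `^ q^-1)%E
  | +oo%E => ereal_sup [set `|f x|%:E | x in Om]
  | -oo%E => 0%E
  end.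

(* msize is the total degree plus one. *)
Definition poly_on (n : nat) : set (pt -> R) :=
  [set f | exists2 p : mpoly d R, (msize p <= n.+1)%N &
           forall x, Om x -> f x = peval p x].

Section Orthogonality.
Context (varpi : pt -> R).

Definition inner (f g : pt -> R) : R :=
  \int[m]_(x in Om) (f x * g x * varpi x).

Definition orthopoly (n : nat) : set (pt -> R) :=
  [set f | poly_on n f /\ forall k g, (k < n)%N -> poly_on k g -> inner f g = 0].

Definition reproducing_kernel (P : nat -> pt -> pt -> R) : Prop :=
  forall n x, Om x ->
    orthopoly n (P n x) /\ forall f, orthopoly n f -> f x = inner f (P n x).

Definition is_proj (n : nat) (f g : pt -> R) : Prop :=
  orthopoly n g /\ forall h, orthopoly n h -> inner (fun x => f x - g x) h = 0.

(* g is the polynomial (- D_varpi)^(r/2) f; it is unique on Omega as soon as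
   the spaces orthopoly n have reproducing kernels, since inner is then positive
   definite on polynomials. *)
Definition is_fractional_power (mu : {poly R}) (r : R) (f g : pt -> R) : Prop :=
  (exists N, poly_on N g) /\
  forall n u, is_proj n f u ->
    is_proj n g (fun x => mu.[n%:R] `^ (r / 2) * u x).

End Orthogonality.

Definition diffop (a : 'I_d -> 'I_d -> pt -> R) (b : 'I_d -> pt -> R)
    (c : pt -> R) (p : mpoly d R) (x : pt) : R :=
  \sum_(i < d) \sum_(j < d)
    a i j x * peval (mderiv i (mderiv j p)) x
  + \sum_(i < d) b i x * peval (mderiv i p) x
  + c x * peval p x.

(* When Omega is a surface the identity for all polynomials p restricting to an
   element of orthopoly n makes the operator independent of the extension of
   Y to R^d. *)
Definition eigen_operator (varpi : pt -> R) (mu : {poly R}) : Prop :=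
  [/\ size mu = 3%N, forall n : nat, 0 <= mu.[n%:R]
    & exists a b c, forall n (p : mpoly d R), orthopoly varpi n (peval p) ->
        forall x, Om x -> diffop a b c p x = - mu.[n%:R] * peval p x].

End Setting.

Section Jacobi.
Context {R : realType}.
Implicit Types (al be t : R) (n : nat).

Definition gbinom (a : R) (k : nat) : R :=
  (\prod_(i < k) (a - i%:R)) / (k`!)%:R.

Definition jacobi al be n t : R :=
  \sum_(s < n.+1) gbinom (n%:R + al) (n - s) * gbinom (n%:R + be) s
    * ((t - 1) / 2) ^+ s * ((t + 1) / 2) ^+ (n - s).

Definition jacobi_weight al be t : R := (1 - t) `^ al * (1 + t) `^ be.

Definition jacobi_h al be n : R :=
  (\int[lebesgue_measure]_(t in `[-1, 1])
     (jacobi al be n t ^+ 2 * jacobi_weight al be t))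
  / (\int[lebesgue_measure]_(t in `[-1, 1]) jacobi_weight al be t).

Definition jacobi_Z al be n t : R :=
  jacobi al be n 1 * jacobi al be n t / jacobi_h al be n.

Definition cube (k : nat) : set (euclid R k) :=
  [set u | forall i, -1 <= (u : 'rV[R]_k) ord0 i <= 1].

End Jacobi.

Arguments cube {R} k _.

Definition addition_formula (R : realType) (d : nat) (X : mdomain R d)
    (P : nat -> euclid R d -> euclid R d -> R) : Prop :=
  exists (al be : R) (k : nat) (tau : probability (euclid R k) R)
         (xi : euclid R d -> euclid R d -> euclid R k -> R),
    [/\ - 2^-1 <= be <= al, (0 < k)%N, tau (cube k) = 1%E,
        forall x y, Omega X x -> Omega X y ->
          [/\ measurable_fun (cube k) (xi x y),
              forall u, cube k u -> -1 <= xi x y u <= 1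
            & forall u, cube k u -> xi x y u = xi y x u]
      & forall n x y, Omega X x -> Omega X y ->
          P n x y = \int[tau]_(u in cube k) jacobi_Z al be n (xi x y u)].

Section Assertions.
Context {R : realType} {d : nat} (X : mdomain R d).
Local Notation pt := (euclid R d).
Local Notation Om := (Omega X).
Local Notation m := (leb X).

Definition smooth (a : R -> R) : Prop :=
  forall k t, derivable (derive1n k a) t 1.

Definition admissible (a : R -> R) : Prop :=
  [/\ smooth a, forall t, 0 <= a t
    & (forall t, 0 <= t <= 1 -> a t = 1) /\ (forall t, 2 < t -> a t = 0)
      \/ (forall t, ~~ (2^-1 <= t <= 2) -> a t = 0)].

Context (varpi : pt -> R) (mu : {poly R}) (P : nat -> pt -> pt -> R).

(* The sums over all k >= 0 stop at 2n, as a vanishes beyond 2. *)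
Definition Lker (a : R -> R) (n : nat) (x y : pt) : R :=
  \sum_(k < (2 * n).+1) a (k%:R / n%:R) * P k x y.

Definition Lker_frac (a : R -> R) (r : R) (n : nat) (x y : pt) : R :=
  \sum_(k < (2 * n).+1) a (k%:R / n%:R) * mu.[k%:R] `^ (r / 2) * P k x y.

Definition bmass (n : nat) (x : pt) : R := wmass X varpi (dball X x n%:R^-1).

Definition decay (n : nat) (kappa : R) (x y : pt) : R :=
  (1 + n%:R * mdist X x y) `^ (- kappa).

Definition Assertion1 : Prop :=
  forall a, admissible a -> forall kappa : R, 0 < kappa ->
  exists c : R, forall n x y, (0 < n)%N -> Om x -> Om y ->
    `|Lker a n x y|
      <= c / Num.sqrt (bmass n x * bmass n y) * decay n kappa x y.

Definition Assertion2 : Prop :=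
  forall a, admissible a -> exists delta0 : R, 0 < delta0 < 1 /\
  forall kappa : R, 0 < kappa ->
  exists c : R, forall (delta : R) n x1 x2 y,
    0 < delta <= delta0 -> (0 < n)%N ->
    Om x2 -> dball X x2 (delta / n%:R) x1 -> Om y ->
    `|Lker a n x1 y - Lker a n x2 y|
      <= c * n%:R * mdist X x1 x2 / Num.sqrt (bmass n x1 * bmass n x2)
         * decay n kappa x2 y.

Definition Assertion3 : Prop :=
  exists kappa0 : R, forall kappa : R, 0 < kappa -> kappa0 <= kappa ->
  exists c : R, forall n x, (0 < n)%N -> Om x ->
    (\int[m]_(y in Om) (varpi y / bmass n y * decay n kappa x y)%:E <= c%:E)%E.

Definition Assertion4 : Prop :=
  compact (Om : set 'rV[R]_d) /\
  exists (T : nat -> pt -> pt -> R) (q : nat -> pt -> R),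
    [/\ forall n x, (0 < n)%N -> Om x ->
          [/\ poly_on X n (T n x), forall y, Om y -> 0 <= T n x y & T n x x = 1],
        exists2 delta' : R, 0 < delta' &
          forall n x y, (0 < n)%N -> Om x -> dball X x n%:R^-1 y ->
            delta' <= T n x y,
        forall gamma : R, 1 < gamma ->
          exists c : R, forall n x y, (0 < n)%N -> Om x -> Om y ->
            T n x y <= c * decay n gamma x y,
        exists2 rho : nat, (0 < rho)%N &
          forall n y, (0 < n)%N -> Om y ->
            poly_on X (rho * n) (fun x => q n x * T n x y)
      & (forall n, (0 < n)%N -> exists N, poly_on X N (q n)) /\
        exists c1 c2 : R, 0 < c1 /\
          forall n x, (0 < n)%N -> Om x -> c1 <= q n x <= c2].

Definition Assertion5 : Prop :=
  forall a, admissible a -> forall r kappa : R, 0 < r -> 0 < kappa ->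
  exists c : R, forall n x y, (0 < n)%N -> Om x -> Om y ->
    `|Lker_frac a r n x y|
      <= c * n%:R `^ r / Num.sqrt (bmass n x * bmass n y) * decay n kappa x y.

End Assertions.

(* Main.v *)
Require Import Defs.
From HB Require Import structures.
From mathcomp Require Import all_boot all_order all_algebra.
From mathcomp Require Import all_classical all_reals all_analysis.
From mathcomp Require Import measurable_realfun.
From mathcomp Require Import -(notations) mpoly.
From mathcomp Require Import ring lra.

Set Implicit Arguments.
Unset Strict Implicit.
Unset Printing Implicit Defensive.

Import Order.TTheory GRing.Theory Num.Theory.
Import numFieldNormedType.Exports.

Local Open Scope classical_set_scope.
Local Open Scope ring_scope.

(* Choose a cut-off equal to 1 on [0, 1].  As f has degree at most n, both f
   and g = (- D_varpi)^(r/2) f are integrals of f against the kernels Lker and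
   Lker_frac, so Assertions 5 and 3 give
   |g x| <= c n^r sup_u |f u| / (1 + n d(x, u))^beta for every beta, which is
   the case p = oo.  For p < oo let y nearly attain the supremum.  Assertions 2
   and 3 bound the oscillation of f at scale delta / n around y by |f y| / 2, so
   that |f y|^p is at most 2^p times the w-average of |f|^p over
   B(y, delta / n).  Cover Omega by countably many disjoint cells E_k of radius
   delta / n with centres z_k and sum the resulting bound over the cells: the
   integral against w of |g|^p is at most (c n^r)^p times
     sum_k w(B(z_k, 1/n))^-1 (int_(E_k) |f|^p w)
             (int (1 + n d(x, z_k))^-beta w(x) dx),
   and for beta large the last factor is at most c w(B(z_k, 1/n)). *)

(** * A smooth cut-off *)

(** The weight [w] is unrelated to [varpi], whereas the masses and integrals in the kernel estimates
    are those of [varpi]; these estimates therefore serve only for pointwise bounds on f and g, and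
    [w] enters afterwards through its own doubling property. The near maximum y depends on x in an
    uncontrolled way, possibly not measurably, so a bound that still contains y cannot be integrated
    in x. Replacing the ball around y by a sum over a fixed countable partition, weighted by the
    decay in d(x, z_k), removes y and leaves a function of x that can be integrated term by term.
    The exponent beta is one more than the growth exponent of the balls of [w], which makes the sum
    over dyadic annuli converge. It does not vary with p, because raising a number in [0, 1] to a
    power p >= 1 only decreases it. *)

Section Smoothness.
Context {R : realType}.
Implicit Types f g : R -> R.

(* Differentiable k + 1 times. *)
Fixpoint diffn (k : nat) f : Prop :=
  (forall t, derivable f t 1) /\ if k is j.+1 then diffn j (derive1 f) else True.

Lemma diffnS k f : diffn k.+1 f -> diffn k f.
Proof.
elim: k f => [|k IH] f [df d'f]; first by split.
by split=> //; apply: IH.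
Qed.

Lemma smooth_diffn f : (forall k, diffn k f) -> smooth f.
Proof.
move=> df k; have {df} := df k; elim: k f => [|k IH] f; first by case.
by move=> [_ df] t; rewrite derive1Sn; exact: IH.
Qed.

Lemma diffnD k f g : diffn k f -> diffn k g -> diffn k (f \+ g).
Proof.
elim: k f g => [|k IH] f g [df d'f] [dg d'g]; first by split=> [t|//]; exact: derivableD.
split=> [t|]; first exact: derivableD.
suff -> : derive1 (f \+ g) = derive1 f \+ derive1 g by apply: IH.
by apply/funext => t; rewrite /= !derive1E deriveD.
Qed.

Lemma diffnM k f g : diffn k f -> diffn k g -> diffn k (f \* g).
Proof.
elim: k f g => [|k IH] f g hf hg.
  by case: hf hg => df _ [dg _]; split=> [t|//]; exact: derivableM.
have [df d'f] := hf; have [dg d'g] := hg.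
split=> [t|]; first exact: derivableM.
suff -> : derive1 (f \* g) = (f \* derive1 g) \+ (g \* derive1 f).
  by apply: diffnD; apply: IH => //; exact: diffnS.
by apply/funext => t; rewrite /= !derive1E deriveM.
Qed.

Lemma diffn_comp k f g : diffn k f -> diffn k g -> diffn k (f \o g).
Proof.
have dcomp (u v : R -> R) (t : R) : derivable u (v t) 1 -> derivable v t 1 ->
    derivable (u \o v) t 1.
  by move=> du dv; apply/derivable1_diffP; apply: differentiable_comp;
    exact/derivable1_diffP.
elim: k f g => [|k IH] f g hf hg.
  by case: hf hg => df _ [dg _]; split=> [t|//]; exact: dcomp.
have [df d'f] := hf; have [dg d'g] := hg.
split=> [t|]; first exact: dcomp.
suff -> : derive1 (f \o g) = (derive1 f \o g) \* derive1 g.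
  by apply: diffnM => //; apply: IH => //; exact: diffnS.
by apply/funext => t; rewrite derive1_comp.
Qed.

Lemma diffn_cst k (c : R) : diffn k (cst c).
Proof.
elim: k c => [|k IH] c; first by split.
split=> //; rewrite (_ : derive1 _ = (cst 0 : R -> R))//.
by apply/funext => t; rewrite derive1_cst.
Qed.

Lemma diffn_id k : diffn k (id : R -> R).
Proof.
case: k => [|k]; split=> //.
rewrite (_ : derive1 _ = (cst 1 : R -> R)); first exact: diffn_cst.
by apply/funext => t; rewrite derive1E derive_id.
Qed.

(** The polynomial in 1/t makes the class closed under differentiation, so that smoothness follows
    by an induction over all p at once. *)
Definition flat_exp (p : {poly R}) (t : R) : R :=
  if 0 < t then p.[t^-1] * expR (- t^-1) else 0.

(** With y = 1/t, the exponential series gives exp y >= y^(N+2) / (N+2)! for N the size of p, which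
    beats p(y) by two powers of y. The square of t is what forces the derivative at 0 to vanish. *)
Lemma flat_exp_le (p : {poly R}) :
  exists2 C, 0 <= C & forall t, 0 < t <= 1 -> `|flat_exp p t| <= C * t ^+ 2.
Proof.
pose A := \sum_(i < size p) `|p`_i|.
have A0 : 0 <= A by exact: sumr_ge0.
exists (A * (size p).+2`!%:R) => [|t /andP[t0 t1]]; first by rewrite mulr_ge0.
rewrite /flat_exp t0 normrM (gtr0_norm (expR_gt0 _)) expRN.
set y := t^-1.
have y1 : 1 <= y by rewrite invf_ge1.
have y0 : 0 < y by exact: lt_le_trans y1.
have hp : `|p.[y]| <= A * y ^+ size p.
  rewrite horner_coef (le_trans (ler_norm_sum _ _ _))// /A mulr_suml.
  apply: ler_sum => i _; rewrite normrM ler_wpM2l// normrX (gtr0_norm y0).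
  by rewrite ler_weXn2l// ltnW.
have he : y ^+ (size p).+2 / (size p).+2`!%:R <= expR y.
  by apply: le_trans (expR_ge1Dxn (size p).+1 (ltW y0)); rewrite lerDr.
have -> : t ^+ 2 = y ^+ size p / y ^+ (size p).+2.
  by rewrite -(addn2 (size p)) exprD invfM mulVKf ?expf_neq0 ?gt_eqF// -exprVn invrK.
rewrite mulrACA; apply: ler_pM => //.
rewrite -[leRHS]invf_div lef_pV2// posrE ?expR_gt0// divr_gt0 ?exprn_gt0// ltr0n fact_gt0.
Qed.

Lemma cvg_is_derive1 f (t df : R) :
  (h^-1 * (f (t + h) - f t) @[h --> 0^'] --> df) -> is_derive t (1 : R) f df.
Proof.
move=> fdf.
have E : (fun h : R => h^-1 *: ((f \o shift t) (h *: (1 : R)) - f t)) =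
    (fun h => h^-1 * (f (t + h) - f t)).
  by apply/funext => h /=; rewrite /GRing.scale/= mulr1 (addrC h t).
apply: DeriveDef; first by rewrite /derivable E; apply/cvg_ex; exists df.
by rewrite /derive E; apply/cvg_lim.
Qed.

Lemma is_derive1_cvg f (t df : R) : is_derive t (1 : R) f df ->
  h^-1 * (f (t + h) - f t) @[h --> 0^'] --> df.
Proof.
move=> [+ <-]; rewrite /derivable /derive.
rewrite (_ : (fun h : R => h^-1 *: ((f \o shift t) (h *: (1 : R)) - f t)) =
    (fun h => h^-1 * (f (t + h) - f t)) )//.
by apply/funext => h /=; rewrite /GRing.scale/= mulr1 (addrC h t).
Qed.

Lemma near_is_derive1 f g (t df : R) : (\forall s \near t, f s = g s) ->
  is_derive t (1 : R) f df -> is_derive t (1 : R) g df.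
Proof.
move=> fg /is_derive1_cvg fdf; apply: cvg_is_derive1.
have ft := nbhs_singleton fg.
move: fdf; apply: cvg_trans; apply: near_eq_cvg.
have : \forall h \near (0 : R), f (t + h) = g (t + h).
  by move: fg; rewrite (near_shift 0); apply: filterS => h; rewrite /= subr0 addrC.
by move=> /nbhs_dnbhs; apply: filterS => h ->; rewrite ft.
Qed.

(** For t > 0 and y = 1/t one has y' = - y^2, hence (p(y) exp(-y))' = y^2 (p(y) - p'(y)) exp(-y). At
    0 the difference quotient is at most C |h|. *)
Lemma is_derive_flat_exp (p : {poly R}) (t : R) :
  is_derive t (1 : R) (flat_exp p) (flat_exp ('X^2 * (p - p^`())) t).
Proof.
have [t0|t0|->] := ltgtP t 0.
- rewrite {2}/flat_exp ltNge (ltW t0)/=.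
  apply: (@near_is_derive1 (cst 0)).
    near=> s; rewrite /flat_exp ltNge (_ : s <= 0)//.
    by near: s; exact: lt_le_nbhsl.
- apply: (@near_is_derive1 (fun s => p.[s^-1] * expR (- s^-1))).
    near=> s; rewrite /flat_exp (_ : 0 < s)//.
    by near: s; exact: lt_nbhsr.
  have dV : is_derive t (1 : R) (fun s : R => s^-1) (- t ^- 2).
    have := @is_deriveV _ id t _ _ (lt0r_neq0 t0) (is_derive_id t 1).
    by rewrite /GRing.scale/= mulr1.
  have dh : is_derive t^-1 (1 : R) (horner p) p^`().[t^-1].
    by split; [exact: derivable_horner|rewrite -derive1E -derivE].
  have dp : is_derive t (1 : R) (horner p \o (fun s : R => s^-1)) (p^`().[t^-1] * - t ^- 2).
    exact: is_derive1_comp.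
  have dN : is_derive t (1 : R) (fun s : R => - s^-1) (t ^- 2).
    by have := is_deriveN dV; rewrite opprK.
  have de : is_derive t (1 : R) (expR \o (fun s : R => - s^-1)) (expR (- t^-1) * t ^- 2).
    exact: is_derive1_comp.
  apply: (is_derive_eq (is_deriveM dp de)).
  rewrite /flat_exp t0 !hornerE -exprVn -[LHS]/(p.[t^-1] * (expR (- t^-1) * t^-1 ^+ 2) +
    expR (- t^-1) * (p^`().[t^-1] * - t^-1 ^+ 2)).
  by ring.
- rewrite {2}/flat_exp ltxx; apply: cvg_is_derive1.
  have [C C0 hC] := flat_exp_le p.
  apply/cvgr0Pnorm_le => e e0.
  have : \forall h \near (0 : R), `|h| < Num.min 1 (e / (C + 1)).
    apply: nbhs0_lt; rewrite lt_min ltr01 divr_gt0//; lra.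
  move=> /nbhs_dnbhs; apply: filterS => h; rewrite lt_min => /andP[h1 he].
  rewrite add0r {2}/flat_exp ltxx subr0 normrM normfV.
  have [h0|h0] := leP h 0; first by rewrite /flat_exp ltNge h0 normr0 mulr0 ltW.
  rewrite (gtr0_norm h0) in h1 he *.
  rewrite mulrC ler_pdivrMr//; apply: le_trans (hC _ _) _; first by rewrite h0 ltW.
  rewrite expr2 mulrA ler_pM2r//.
  move: he; rewrite ltr_pdivlMr; last lra.
  by rewrite mulrDr mulr1 mulrC => ?; lra.
Unshelve. all: by end_near. Qed.

Lemma diffn_flat_exp k p : diffn k (flat_exp p).
Proof.
have dp q t : derivable (flat_exp q) t 1 by have [] := is_derive_flat_exp q t.
elim: k p => [|k IH] p; first by split=> [t|//]; exact: dp.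
split=> [t|]; first exact: dp.
rewrite (_ : derive1 _ = flat_exp ('X^2 * (p - p^`()))); first exact: IH.
by apply/funext => t; rewrite derive1E; have [_ ->] := is_derive_flat_exp p t.
Qed.

(* With phi t := exp (- 1 / t) for t > 0, the cut-off is
   phi (phi 1 - phi (t - 1)) / phi (phi 1). *)
Lemma exists_cutoff : exists a : R -> R,
  admissible a /\ forall t, 0 <= t <= 1 -> a t = 1.
Proof.
pose phi := flat_exp 1.
have phiE t : 0 < t -> phi t = expR (- t^-1).
  by rewrite /phi /flat_exp => ->; rewrite hornerC mul1r.
have phi0 t : t <= 0 -> phi t = 0 by rewrite /phi /flat_exp ltNge => ->.
have phige t : 0 <= phi t.
  by rewrite /phi /flat_exp; case: ifP => // _; rewrite hornerC mul1r expR_ge0.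
have phi1 : 0 < phi 1 by rewrite phiE ?expR_gt0.
have phiphi1 : 0 < phi (phi 1) by rewrite phiE ?expR_gt0.
pose a t := phi (phi 1 - phi (t - 1)) * (phi (phi 1))^-1.
have a1 t : 0 <= t <= 1 -> a t = 1.
  by move=> /andP[_ t1]; rewrite /a (phi0 (t - 1)) ?subr_le0// subr0 divff ?gt_eqF.
exists a; split=> //; split.
- apply: smooth_diffn => k.
  have -> : a = (phi \o (cst (phi 1) \+ (cst (-1) \* (phi \o (id \+ cst (-1))))))
      \* cst (phi (phi 1))^-1.
    by apply/funext => t; rewrite /a /= mulN1r.
  apply: diffnM; last exact: diffn_cst.
  apply: diffn_comp; first exact: diffn_flat_exp.
  apply: diffnD; first exact: diffn_cst.
  apply: diffnM; first exact: diffn_cst.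
  apply: diffn_comp; first exact: diffn_flat_exp.
  by apply: diffnD; [exact: diffn_id|exact: diffn_cst].
- by move=> t; rewrite /a mulr_ge0 ?phige// invr_ge0.
(* Beyond 2 one has t - 1 >= 1, so phi (t - 1) >= phi 1 and the outer phi receives a nonpositive
   argument. *)
- left; split=> // t t2; rewrite /a phi0 ?mul0r// subr_le0 !phiE//; last by lra.
  rewrite ler_expR lerN2 invr1 invf_le1; lra.
Qed.

End Smoothness.

(** * Polynomials on Omega *)

Section PolynomialFunctions.
Context {R : realType} {d : nat} (X : mdomain R d).
Local Notation pt := (euclid R d).
Local Notation Om := (Omega X).
Local Notation m := (leb X).
Implicit Types f g : pt -> R.

Lemma measurable_peval (p : mpoly d R) : measurable_fun setT (peval p).
Proof.
rewrite /peval; under eq_fun do rewrite mevalE.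
apply: measurable_sum => M; apply: measurable_funM => //.
apply: measurable_prod => i _; apply: measurable_funX.
apply: (measurability _ (RGenOpens.measurableE R)).
move=> _ [_ [a [b ->] <-]]; rewrite setTI; apply: sub_sigma_algebra.
have /continuousP cc := @coord_continuous R 1 d ord0 i.
exact/cc/interval_open.
Qed.

Lemma poly_on_measurable n f : measurable Om -> poly_on X n f -> measurable_fun Om f.
Proof.
move=> mOm [p _ fp]; apply: (eq_measurable_fun (peval p)).
  by move=> x /set_mem /fp.
exact: measurable_funTS (measurable_peval p).
Qed.

Lemma poly_on_bounded n f : compact (Om : set 'rV[R]_d) -> poly_on X n f ->
  exists2 M, 0 <= M & forall x, Om x -> `|f x| <= M.
Proof.
move=> cOm [p _ fp].
have [B hB] : exists B : 'I_d -> R, forall i x, Om x -> `|(x : 'rV_d) ord0 i| <= B i.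
  suff /choice[B hB] : forall i, exists b, forall x, Om x -> `|(x : 'rV[R]_d) ord0 i| <= b.
    by exists B.
  move=> i; have /compact_bounded[b [_ hb]] :=
    continuous_compact (continuous_subspaceT (@coord_continuous R 1 d ord0 i)) cOm.
  by exists (b + 1) => x Ox; apply: (hb (b + 1)); [rewrite ltrDl|exists x].
exists (\sum_(M <- msupp p) `|mcoeff M p| * \prod_i `|B i| ^+ M i).
  by apply: sumr_ge0 => M _; rewrite mulr_ge0// prodr_ge0.
move=> x Ox; rewrite fp// /peval mevalE (le_trans (ler_norm_sum _ _ _))//.
apply: ler_sum => M _; rewrite normrM ler_wpM2l// normr_prod.
apply: ler_prod => i _; rewrite normr_ge0 normrX/= lerXn2r ?nnegrE//.
by rewrite (le_trans (hB i x Ox))// ler_norm.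
Qed.

Lemma poly_on_le n k f : (n <= k)%N -> poly_on X n f -> poly_on X k f.
Proof. by move=> nk [p sp fp]; exists p => //; exact: leq_trans sp _. Qed.

Lemma poly_on_ext n f g : (forall x, Om x -> f x = g x) -> poly_on X n f -> poly_on X n g.
Proof. by move=> fg [p sp fp]; exists p => // x Ox; rewrite -fg// fp. Qed.

Lemma poly_on0 n : poly_on X n (cst 0).
Proof. by exists 0 => [|x Ox]; rewrite ?msize0// /peval meval0. Qed.

Lemma poly_on_lin n (a : R) f g : poly_on X n f -> poly_on X n g ->
  poly_on X n (fun x => a * f x + g x).
Proof.
move=> [p sp fp] [q sq gq]; exists (a *: p + q) => [|x Ox].
  rewrite (leq_trans (msizeD_le _ _))// geq_max sq (leq_trans (msizeZ_le _ _))//.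
by rewrite fp// gq// /peval mevalD mevalZ.
Qed.

Lemma poly_on_sum n I (s : seq I) (F : I -> pt -> R) :
  (forall i, poly_on X n (F i)) -> poly_on X n (fun x => \sum_(i <- s) F i x).
Proof.
move=> hF; elim: s => [|i s IH].
  by apply: poly_on_ext (poly_on0 n) => x _; rewrite big_nil.
apply: poly_on_ext (poly_on_lin 1 (hF i) IH) => x _.
by rewrite big_cons mul1r.
Qed.

Definition monomial_fun (M : multinom d) (x : pt) : R :=
  \prod_i ((x : 'rV_d) ord0 i) ^+ M i.

(** Finite generation is all that projecting onto polynomials of degree at most n requires; the
    monomials may well be linearly dependent on Omega. *)
Lemma poly_on_monomials n : exists s : seq (multinom d),
  (forall M, M \in s -> poly_on X n (monomial_fun M)) /\
  forall f, poly_on X n f -> exists c : multinom d -> R,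
    forall x, Om x -> f x = \sum_(M <- s) c M * monomial_fun M x.
Proof.
exists [seq bmnm M | M <- enum {: bmultinom d n.+1}]; split.
  move=> M /mapP[M' _ ->]; exists (mpolyX R M'); first by rewrite msizeX bmdeg.
  by move=> x Ox; rewrite /peval mevalX.
move=> f [p sp fp]; exists (fun M => mcoeff M p) => x Ox.
rewrite fp// big_map big_enum/= /peval {1}(mpolywE sp) raddf_sum/=.
by apply: eq_bigr => M _; rewrite mevalZ mevalX.
Qed.

End PolynomialFunctions.

(** * Orthogonal expansions *)

Lemma weight_integrableM (R : realType) (d : nat) (X : mdomain R d)
    (w h : euclid R d -> R) (M : R) : measurable (Omega X) -> weight X w ->
  measurable_fun (Omega X) h -> (forall x, Omega X x -> `|h x| <= M) ->
  (leb X).-integrable (Omega X) (fun x => (h x * w x)%:E).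
Proof.
move=> mOm [w0 iw] mh hM.
have mw : measurable_fun (Omega X) w.
  by apply/measurable_EFinP; exact: measurable_int iw.
apply: (le_integrable _ _ _ (integrableZl mOm M iw)) => //.
  by apply/measurable_EFinP; exact: measurable_funM.
move=> x Ox; rewrite -EFinM !abse_EFin lee_fin !normrM ler_wpM2r//.
by rewrite (le_trans (hM x Ox))// ler_norm.
Qed.

Section Orthogonal.
Context {R : realType} {d : nat} (X : mdomain R d).
Local Notation pt := (euclid R d).
Local Notation Om := (Omega X).
Context (mOm : measurable Om) (cOm : compact (Om : set 'rV[R]_d)).
Context (varpi : pt -> R) (wvarpi : weight X varpi).
Local Notation inner := (inner X varpi).
Implicit Types f g h u v : pt -> R.

Definition polyfun f : Prop := exists n, poly_on X n f.

Lemma polyfun_lin (a : R) f g : polyfun f -> polyfun g ->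
  polyfun (fun x => a * f x + g x).
Proof.
move=> [n pf] [k pg]; exists (maxn n k).
by apply: poly_on_lin; [apply: poly_on_le pf|apply: poly_on_le pg];
  rewrite ?leq_maxl ?leq_maxr.
Qed.

Lemma inner_integrable f g : polyfun f -> polyfun g ->
  (leb X).-integrable Om (EFin \o (fun x => f x * g x * varpi x)).
Proof.
move=> [n pf] [k pg].
have [M M0 hM] := poly_on_bounded cOm pf; have [N N0 hN] := poly_on_bounded cOm pg.
apply: (@weight_integrableM _ _ _ _ _ (M * N)) => //.
  by apply: measurable_funM; [exact: poly_on_measurable pf|exact: poly_on_measurable pg].
by move=> x Ox; rewrite normrM ler_pM// ?hM ?hN.
Qed.

Lemma inner_ext f g u v : (forall x, Om x -> f x = u x) ->
  (forall x, Om x -> g x = v x) -> inner f g = inner u v.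
Proof.
by move=> fu gv; apply: eq_Rintegral => x /set_mem Ox; rewrite fu// gv.
Qed.

Lemma innerC f g : inner f g = inner g f.
Proof. by apply: eq_Rintegral => x _; rewrite (mulrC (f x)). Qed.

Lemma inner_lin a f g h : polyfun f -> polyfun g -> polyfun h ->
  inner (fun x => a * f x + g x) h = a * inner f h + inner g h.
Proof.
move=> pf pg ph; rewrite /Defs.inner -RintegralZl//; last exact: inner_integrable.
rewrite -RintegralD//; last exact: inner_integrable.
  by apply: eq_Rintegral => x _; ring.
have := integrableZl mOm a (inner_integrable pf ph).
by apply: eq_integrable => // x _; rewrite /= EFinM.
Qed.

Lemma inner_linr a f g h : polyfun f -> polyfun g -> polyfun h ->
  inner h (fun x => a * f x + g x) = a * inner h f + inner h g.
Proof. by move=> pf pg ph; rewrite innerC inner_lin// !(innerC h). Qed.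

Lemma inner_sub f g h : polyfun f -> polyfun g -> polyfun h ->
  inner (fun x => f x - g x) h = inner f h - inner g h.
Proof.
move=> pf pg ph; rewrite -[RHS]addrC -mulN1r -inner_lin//.
by apply: inner_ext => // x _; rewrite mulN1r addrC.
Qed.

Lemma polyfun_sub f g : polyfun f -> polyfun g -> polyfun (fun x => f x - g x).
Proof.
move=> pf pg; have [n hn] := polyfun_lin (-1) pg pf; exists n.
by apply: poly_on_ext hn => x _; rewrite mulN1r addrC.
Qed.

Lemma inner0 h : inner (cst 0) h = 0.
Proof.
rewrite /Defs.inner; under eq_Rintegral do rewrite /= !mul0r.
by rewrite Rintegral_cst// mul0r.
Qed.

Lemma inner_ge0 f : 0 <= inner f f.
Proof. by apply: Rintegral_ge0 => x Ox; rewrite mulr_ge0 ?sqr_ge0 ?wvarpi.1//. Qed.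

Lemma inner_sum (I : eqType) (s : seq I) (F : I -> pt -> R) h :
  (forall i, i \in s -> polyfun (F i)) -> polyfun h ->
  polyfun (fun x => \sum_(i <- s) F i x) /\
  inner (fun x => \sum_(i <- s) F i x) h = \sum_(i <- s) inner (F i) h.
Proof.
move=> + ph; elim: s => [_|i s IH pF].
  split; first by exists 0%N; apply: poly_on_ext (poly_on0 X 0) => x _; rewrite big_nil.
  rewrite big_nil; apply: (etrans _ (inner0 h)).
  by apply: inner_ext => // x _; rewrite big_nil.
have [j js|ps IHs] := IH; first by apply: pF; rewrite inE js orbT.
have pi : polyfun (F i) by apply: pF; rewrite mem_head.
have E x : \sum_(j <- i :: s) F j x = 1 * F i x + \sum_(j <- s) F j x.
  by rewrite big_cons mul1r.
split.
  have [n hn] := polyfun_lin 1 pi ps; exists n.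
  by apply: poly_on_ext hn => x _; rewrite E.
rewrite big_cons -IHs -[X in X + _]mul1r -inner_lin//.
by apply: inner_ext => // x _; rewrite E.
Qed.

(** Cauchy-Schwarz for a semidefinite form: with t = - B / (A + 1) the square of t u + b is - (B /
    (A + 1))^2 (A + 2), which is negative unless B = 0. The denominator A + 1 avoids the case A =
    0. *)
Lemma inner_isotropic b u : polyfun b -> polyfun u -> inner b b = 0 -> inner u b = 0.
Proof.
move=> pb pu bb; apply: contrapT => /eqP B0.
set B := inner u b in B0; set A := inner u u.
have A0 : 0 <= A by exact: inner_ge0.
pose t : R := - B / (A + 1).
have pt : polyfun (fun x => t * u x + b x) by exact: polyfun_lin.
have := inner_ge0 (fun x => t * u x + b x).
rewrite inner_lin// !inner_linr// bb (innerC b) -/A -/B /t.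
have A1 : A + 1 != 0 by rewrite gt_eqF// ltr_wpDl.
suff -> : - B / (A + 1) * (- B / (A + 1) * A + B) + (- B / (A + 1) * B + 0) =
    - ((B / (A + 1)) ^+ 2 * (A + 2)).
  rewrite oppr_ge0 leNgt pmulr_rgt0 ?ltr_wpDl//.
  by rewrite lt_neqAle sqr_ge0 eq_sym sqrf_eq0 mulf_neq0// invr_eq0.
by field.
Qed.

Definition lin_closed (W : set (pt -> R)) : Prop :=
  W (cst 0) /\ forall a u v, W u -> W v -> W (fun x => a * u x + v x).

(* The form may be degenerate.  Quantifying over all subspaces W expresses that
   g lies in the span of the e i. *)
Lemma gram_schmidt (I : eqType) (e : I -> pt -> R) (s : seq I) :
  (forall i, i \in s -> polyfun (e i)) -> forall f, polyfun f ->
  exists g, (forall W, lin_closed W -> (forall i, i \in s -> W (e i)) -> W g) /\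
            (forall i, i \in s -> inner (fun x => f x - g x) (e i) = 0).
Proof.
elim: s => [_ f pf|i s IH pe f pf].
  by exists (cst 0); split=> // W [].
have pi : polyfun (e i) by apply: pe; rewrite mem_head.
have ps j : j \in s -> polyfun (e j) by move=> js; apply: pe; rewrite inE js orbT.
have closed_poly : lin_closed polyfun.
  by split; [exists 0%N; exact: poly_on0|move=> *; exact: polyfun_lin].
(* The induction hypothesis is used twice: g1 projects f, and h projects the new vector [e i], so
   that b = e i - h is a new direction orthogonal to the old ones. *)
have [g1 [Wg1 og1]] := IH ps _ pf.
have [h [Wh oh]] := IH ps _ pi.
have pg1 := Wg1 _ closed_poly ps; have ph := Wh _ closed_poly ps.
pose b x := e i x - h x.
have pb : polyfun b by exact: polyfun_sub.
have pfg1 : polyfun (fun x => f x - g1 x) by exact: polyfun_sub.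
pose t : R := inner (fun x => f x - g1 x) b / inner b b.
have ptb : polyfun (fun x => t * b x + g1 x) by exact: polyfun_lin.
have innerE u : polyfun u -> inner (fun x => f x - (t * b x + g1 x)) u =
    inner (fun x => f x - g1 x) u - t * inner b u.
  by move=> pu; rewrite (inner_sub pf ptb pu) (inner_sub pf pg1 pu) inner_lin//; ring.
have ob : inner (fun x => f x - (t * b x + g1 x)) b = 0.
  (* If b is isotropic, then t = 0 because division by 0 gives 0, and every polynomial is orthogonal
     to b. *)
  rewrite innerE// /t; have [bb|bb] := eqVneq (inner b b) 0.
    by rewrite bb invr0 !mulr0 (inner_isotropic pb)// subr0.
  by rewrite mulfVK// subrr.
have os j : j \in s -> inner (fun x => f x - (t * b x + g1 x)) (e j) = 0.
  by move=> js; rewrite (innerE _ (ps _ js)) (og1 _ js) (oh _ js) mulr0 subr0.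
exists (fun x => t * b x + g1 x); split.
  move=> W cW We.
  have Ws j : j \in s -> W (e j) by move=> js; apply: We; rewrite inE js orbT.
  apply: cW.2; last by apply: Wg1.
  have -> : b = (fun x => -1 * h x + e i x).
    by apply/funext => x; rewrite /b mulN1r addrC.
  by apply: cW.2; [by apply: Wh|apply: We; rewrite mem_head].
move=> j; rewrite inE => /predU1P[->|/os//].
pose F x := f x - (t * b x + g1 x).
have pF : polyfun F by exact: polyfun_sub.
(* As h lies in the span of the earlier vectors, it suffices to take for W the polynomials
   orthogonal to F. *)
have [_ oFh] : polyfun h /\ inner F h = 0.
  apply: (Wh (fun u => polyfun u /\ inner F u = 0)).
    split; first by split; [exact: closed_poly.1|rewrite innerC inner0].
    move=> a u v [pu ou] [pv ov]; split; first exact: polyfun_lin.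
    by rewrite inner_linr// ou ov mulr0 addr0.
  by move=> k ks; split; [exact: ps|exact: os].
have -> : e i = (fun x => 1 * b x + h x).
  by apply/funext => x; rewrite /b mul1r subrK.
by rewrite inner_linr// ob oFh mulr0 addr0.
Qed.

Lemma exists_projection n f : polyfun f -> exists g, poly_on X n g /\
  forall u, poly_on X n u -> inner (fun x => f x - g x) u = 0.
Proof.
move=> pf; have [s [ps spans]] := poly_on_monomials X n.
have ps' M : M \in s -> polyfun (monomial_fun M) by move=> Ms; exists n; exact: ps.
have [g [Wg og]] := gram_schmidt ps' pf.
have pg : poly_on X n g.
  apply: Wg => //; split; first exact: poly_on0.
  by move=> *; exact: poly_on_lin.
exists g; split=> // u /spans[c uE].
pose F x := f x - g x; have pF : polyfun F by apply: polyfun_sub => //; exists n.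
have pc M : M \in s -> polyfun (fun x => c M * monomial_fun M x + cst 0 x).
  by move=> Ms; apply: polyfun_lin; [exact: ps'|exists 0%N; exact: poly_on0].
rewrite innerC.
have -> : inner u F = inner (fun x => \sum_(M <- s) (c M * monomial_fun M x + cst 0 x)) F.
  by apply: inner_ext => // x /uE ->; apply: eq_bigr => M _; rewrite addr0.
rewrite (inner_sum pc pF).2 big_seq big1// => M Ms.
rewrite inner_lin//; [|exact: ps'|by exists 0%N; exact: poly_on0].
by rewrite inner0 innerC og// mulr0 addr0.
Qed.

Lemma orthopoly_polyfun n f : orthopoly X varpi n f -> polyfun f.
Proof. by move=> [pf _]; exists n. Qed.

Lemma orthopoly0 n : orthopoly X varpi n (cst 0).
Proof. by split=> [|k h _ _]; [exact: poly_on0|exact: inner0]. Qed.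

Lemma orthopoly_orthogonal j k f g : j != k ->
  orthopoly X varpi j f -> orthopoly X varpi k g -> inner f g = 0.
Proof.
rewrite neq_ltn => /orP[jk|kj] [pf of_] [pg og]; last exact: of_ pg.
by rewrite innerC; exact: og pf.
Qed.

(** What remains of f after projecting onto degree n is its component of degree n + 1. Allowing any
    N >= n in the sum lets expansions of different lengths be compared over a common range. *)
Lemma orthogonal_decomposition n f : poly_on X n f -> exists v : nat -> pt -> R,
  [/\ forall k, orthopoly X varpi k (v k), forall k, (n < k)%N -> v k = cst 0
    & forall N x, (n <= N)%N -> Om x -> f x = \sum_(k < N.+1) v k x].
Proof.
move=> pf.
suff [v [ov v0 fE]] : exists v : nat -> pt -> R,
    [/\ forall k, orthopoly X varpi k (v k), forall k, (n < k)%N -> v k = cst 0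
    & forall x, Om x -> f x = \sum_(k < n.+1) v k x].
  exists v; split=> // N x nN Ox; rewrite fE// -!(big_mkord xpredT (fun k => v k x)).
  rewrite (@big_cat_nat _ _ _ n.+1 0%N N.+1)//= [X in _ = _ + X]big1_seq ?addr0// => k /=.
  by rewrite mem_index_iota => /andP[nk _]; rewrite v0.
elim: n f pf => [|n IH] f pf.
  exists (fun k => if k is 0 then f else cst 0); split=> [[|k]|[|k]|x Ox] //.
  - exact: orthopoly0.
  - by rewrite big_ord1.
have [g [pg og]] := exists_projection n (ex_intro _ n.+1 pf : polyfun f).
have [v [ov v0 gE]] := IH _ pg.
exists (fun k => if k == n.+1 then (fun x => f x - g x) else v k); split.
- move=> k; case: eqP => [->|_//]; split=> [|j h]; last first.
    by rewrite ltnS => jn ph; apply: og; exact: poly_on_le ph.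
  have pg' : poly_on X n.+1 g by exact: poly_on_le pg.
  by apply: poly_on_ext (poly_on_lin (-1) pg' pf) => x _; rewrite mulN1r addrC.
- by move=> k nk; rewrite gtn_eqF// v0// ltnW.
- move=> x Ox; rewrite big_ord_recr/= eqxx.
  under eq_bigr do rewrite ltn_eqF//.
  by rewrite -gE// addrC subrK.
Qed.

Lemma is_proj_component n f (v : nat -> pt -> R) :
  (forall k, orthopoly X varpi k (v k)) ->
  (forall N x, (n <= N)%N -> Om x -> f x = \sum_(k < N.+1) v k x) ->
  forall k, is_proj X varpi k f (v k).
Proof.
move=> ov fE k; split=> // h oh.
have ph := orthopoly_polyfun oh.
pose N := maxn n k.
have pv j : j \in index_enum 'I_N.+1 -> polyfun (v j).
  by move=> _; exact: orthopoly_polyfun (ov j).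
have [pS SE] := inner_sum pv ph.
have -> : inner (fun x => f x - v k x) h =
    inner (fun x => \sum_(j < N.+1) v j x - v k x) h.
  by apply: inner_ext => // x Ox; rewrite (fE N)// leq_maxl.
rewrite inner_sub//; last exact: orthopoly_polyfun (ov k).
have kN : (k < N.+1)%N by rewrite ltnS leq_maxr.
rewrite SE (bigD1 (Ordinal kN))//= big1 ?addr0 ?subrr// => j jk.
by apply: orthopoly_orthogonal (ov j) oh; apply: contraNneq jk => jk; exact/eqP/val_inj.
Qed.

Context (P : nat -> pt -> pt -> R) (P_kernel : reproducing_kernel X varpi P).

(** No definiteness of the form is assumed: u x and v x are inner products with [P k x], and this
    function is orthogonal to both f - u and f - v. *)
Lemma is_proj_unique k f u v x : polyfun f ->
  is_proj X varpi k f u -> is_proj X varpi k f v -> Om x -> u x = v x.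
Proof.
move=> pf [ou fu] [ov fv] Ox; have [oP rP] := P_kernel k Ox.
have [[pu pv] pP] := (orthopoly_polyfun ou, orthopoly_polyfun ov, orthopoly_polyfun oP).
rewrite (rP _ ou) (rP _ ov).
by move: (fu _ oP) (fv _ oP); rewrite !inner_sub//; lra.
Qed.

Lemma inner_kernel k f u x : polyfun f -> is_proj X varpi k f u -> Om x ->
  inner f (P k x) = u x.
Proof.
move=> pf [ou fu] Ox; have [oP rP] := P_kernel k Ox.
rewrite (rP _ ou); have := fu _ oP.
rewrite inner_sub//; [lra|exact: orthopoly_polyfun ou|exact: orthopoly_polyfun oP].
Qed.

Lemma kernel_sum_polyfun N (c : nat -> R) x : Om x ->
  polyfun (fun y => \sum_(k < N) c k * P k x y).
Proof.
move=> Ox; have pP k : poly_on X k (P k x) by have [[]] := P_kernel k Ox.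
exists N; apply: poly_on_sum => k.
have := poly_on_lin (c k) (poly_on_le (ltnW (ltn_ord k)) (pP k)) (poly_on0 X N).
by apply: poly_on_ext => y _; rewrite addr0.
Qed.

Lemma inner_kernel_sum f (v : nat -> pt -> R) N (c : nat -> R) x : polyfun f ->
  (forall k, is_proj X varpi k f (v k)) -> Om x ->
  inner f (fun y => \sum_(k < N) c k * P k x y) = \sum_(k < N) c k * v k x.
Proof.
move=> pf fv Ox; rewrite innerC.
have pP k : polyfun (P k x) by have [/orthopoly_polyfun] := P_kernel k Ox.
have p0 : polyfun (cst 0) by exists 0%N; exact: poly_on0.
have pF (k : 'I_N) : k \in index_enum 'I_N ->
  polyfun (fun y => c k * P k x y + cst 0 y) by move=> _; exact: polyfun_lin.
rewrite (_ : inner _ f = inner (fun y => \sum_(k < N) (c k * P k x y + cst 0 y)) f).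
  rewrite (inner_sum pF pf).2; apply: eq_bigr => k _.
  by rewrite inner_lin// inner0 addr0 innerC (inner_kernel pf (fv k)).
by apply: inner_ext => // y _; apply: eq_bigr => k _; rewrite addr0.
Qed.

Context (a : R -> R) (a1 : forall t, 0 <= t <= 1 -> a t = 1).

Let cutoff1 n k : (0 < n)%N -> (k <= n)%N -> a (k%:R / n%:R) = 1.
Proof.
move=> n0 kn; rewrite a1// divr_ge0//= ler_pdivrMr ?ltr0n// mul1r ler_nat//.
Qed.

(** The cut-off equals 1 in the degrees k <= n, and f has no components in the others. *)
Lemma Lker_reproduces n f x : (0 < n)%N -> poly_on X n f -> Om x ->
  f x = inner f (Lker P a n x).
Proof.
move=> n0 pnf Ox; have pf : polyfun f by exists n.
have [v [ov v0 fE]] := orthogonal_decomposition pnf.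
have fv := is_proj_component ov fE.
rewrite (inner_kernel_sum _ (fun k => a (k%:R / n%:R)) pf fv Ox).
rewrite (fE (2 * n)%N)//; last by rewrite leq_pmull.
apply: eq_bigr => k _; have [kn|nk] := leqP k n.
  by rewrite cutoff1// mul1r.
by rewrite v0//= mulr0.
Qed.

Lemma Lker_frac_reproduces (mu : {poly R}) r n f g x : (0 < n)%N ->
  poly_on X n f -> is_fractional_power X varpi mu r f g -> Om x ->
  g x = inner f (Lker_frac mu P a r n x).
Proof.
move=> n0 pnf [[K pg] fg] Ox; have pf : polyfun f by exists n.
have [v [ov v0 fE]] := orthogonal_decomposition pnf.
have fv := is_proj_component ov fE.
have [t [ot t0 gE]] := orthogonal_decomposition pg.
have gt := is_proj_component ot gE.
have tE k : t k x = mu.[k%:R] `^ (r / 2) * v k x.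
  by apply: (is_proj_unique (ex_intro _ K pg) (gt k) (fg _ _ (fv k)) Ox).
rewrite (inner_kernel_sum _ (fun k => a (k%:R / n%:R) * mu.[k%:R] `^ (r / 2)) pf fv Ox).
(* The degree K of g may exceed 2n, so both sums are extended to the larger bound; beyond n the
   components of g vanish with those of f. *)
rewrite (gE (maxn K (2 * n))%N) ?leq_maxl//.
rewrite (big_ord_widen (maxn K (2 * n)).+1
  (fun k => a (k%:R / n%:R) * mu.[k%:R] `^ (r / 2) * v k x)).
  rewrite [RHS]big_mkcond; apply: eq_bigr => k _; rewrite tE.
  have [kn|nk] := leqP k n; last by rewrite v0//= !mulr0 if_same.
  by rewrite ltnS (leq_trans kn) ?leq_pmull// cutoff1// mul1r.
by rewrite ltnS leq_maxr.
Qed.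

End Orthogonal.

(** * Doubling weights *)

Lemma pow2_bracket (R : archiRealFieldType) (t : R) : 1 <= t ->
  exists k : nat, t <= 2 ^+ k /\ 2 ^+ k <= 2 * t.
Proof.
move=> t1; have ex : exists k, t <= 2 ^+ k.
  exists (Num.bound t); apply: le_trans (ltW (archi_boundP _)) _; first lra.
  by rewrite -natrX ler_nat ltnW// ltn_expl.
exists (ex_minn ex); case: ex_minnP => k tk mink; split=> //.
case: k tk mink => [|k] tk mink; first by rewrite expr0; lra.
rewrite exprS ler_pM2l// leNgt; apply/negP => /ltW/mink.
by rewrite ltnn.
Qed.

Section Doubling.
Context {R : realType} {d : nat} (X : mdomain R d) (domX : is_domain X).
Local Notation pt := (euclid R d).
Local Notation Om := (Omega X).
Local Notation m := (leb X).
Local Notation D := (Defs.mdist X).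

Let mOm : measurable Om := domain_measurable domX.
Let mball x r : Om x -> 0 < r -> measurable (dball X x r) :=
  @domain_dball _ _ _ domX x r.

Lemma dist_ge0 x y : Om x -> Om y -> 0 <= D x y.
Proof. by have [h _ _ _] := domain_metric domX; exact: h. Qed.

Lemma distxx x : Om x -> D x x = 0.
Proof. by have [_ h _ _] := domain_metric domX; move=> Ox; apply/h. Qed.

Lemma distC x y : Om x -> Om y -> D x y = D y x.
Proof. by have [_ _ h _] := domain_metric domX; exact: h. Qed.

Lemma dist_triangle y x z : Om x -> Om y -> Om z -> D x z <= D x y + D y z.
Proof. by have [_ _ _ h] := domain_metric domX; move=> *; exact: h. Qed.

Lemma dball_sub x y r s : Om x -> Om y -> D x y + s <= r ->
  dball X y s `<=` dball X x r.
Proof.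
move=> Ox Oy rs z [Oz yz]; split=> //.
by have := dist_triangle Ox Oy Oz; lra.
Qed.

Lemma dball_Om x r : dball X x r `<=` Om. Proof. by move=> y []. Qed.

Lemma measurable_dist x : Om x -> measurable_fun Om (D x).
Proof.
move=> Ox; apply: (measurability _ (RGenInftyO.measurableE R)).
move=> _ [_ [a ->] <-].
have [a0|a0] := ltP 0 a.
  rewrite (_ : _ `&` _ = dball X x a); first exact: mball.
  by apply/seteqP; split => y /=; rewrite in_itv.
rewrite (_ : _ `&` _ = set0)//.
apply/seteqP; split => y //= -[Oy]; rewrite in_itv/= => xy.
by have := dist_ge0 Ox Oy; lra.
Qed.

Section Weight.
Context (w : pt -> R) (w_weight : weight X w).
Local Notation W := (wmass X w).
Let w0 x : Om x -> 0 <= w x := w_weight.1 x.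

Lemma weight_measurable : measurable_fun Om w.
Proof. by apply/measurable_EFinP; exact: measurable_int w_weight.2. Qed.

Lemma wmassE E : measurable E -> E `<=` Om ->
  (W E)%:E = (\int[m]_(x in E) (w x)%:E)%E.
Proof.
move=> mE EO; rewrite /wmass /Rintegral fineK//.
by apply: integrable_fin_num => //; exact: integrableS w_weight.2.
Qed.

Lemma wmass_ge0 E : E `<=` Om -> 0 <= W E.
Proof. by move=> EO; apply: Rintegral_ge0 => x /EO; exact: w0. Qed.

Lemma le_wmass E F : measurable E -> measurable F -> E `<=` F -> F `<=` Om ->
  W E <= W F.
Proof.
move=> mE mF EF FO; have EO := subset_trans EF FO.
rewrite -lee_fin !wmassE//; apply: ge0_subset_integral => //.
  by apply/measurable_EFinP; apply: measurable_funS weight_measurable.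
by move=> x /FO Ox; rewrite lee_fin w0.
Qed.

End Weight.

Section DoublingWeight.
Context (w : pt -> R) (w_doubling : doubling_weight X w).
Local Notation W := (wmass X w).
Let w_weight : weight X w := w_doubling.1.
Let w0 x : Om x -> 0 <= w x := w_weight.1 x.

(** Doubling k times, with 2^k between t and 2t, costs L^k; bounding L by 2^s turns this into
    (2^k)^s <= (2t)^s. An integer s keeps all later exponents natural. *)
Lemma doubling_growth : exists s : nat, forall x r t, Om x -> 0 < r -> 1 <= t ->
  W (dball X x (t * r)) <= 2 ^+ s * t ^+ s * W (dball X x r).
Proof.
have [_ [L hL]] := w_doubling.
have [s Ls] : exists s : nat, L <= 2 ^+ s.
  exists (Num.bound `|L|); apply: le_trans (ler_norm _) _.
  apply: le_trans (ltW (archi_boundP _)) _ => //.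
  by rewrite -natrX ler_nat ltnW// ltn_expl.
have W0 x r : 0 <= W (dball X x r) by apply: wmass_ge0 => //; exact: dball_Om.
have iter k x r : Om x -> 0 < r ->
    W (dball X x (2 ^+ k * r)) <= (2 ^+ k) ^+ s * W (dball X x r).
  move=> Ox r0; elim: k => [|k IH]; first by rewrite expr0 expr1n !mul1r.
  rewrite exprS -mulrA exprMn -mulrA.
  apply: le_trans (hL _ _ Ox _) _; first by rewrite mulr_gt0// exprn_gt0.
  by apply: le_trans (ler_wpM2r (W0 _ _) Ls) _; rewrite ler_wpM2l// exprn_ge0.
exists s => x r t Ox r0 t1; have [k [tk kt]] := pow2_bracket t1.
have t0 : 0 < t by lra.
apply: (@le_trans _ _ (W (dball X x (2 ^+ k * r)))).
  apply: le_wmass => //; [exact: mball (mulr_gt0 _ _)|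
    by apply: mball => //; rewrite mulr_gt0// exprn_gt0| |exact: dball_Om].
  by apply: dball_sub => //; rewrite distxx// add0r ler_wpM2r// ltW.
apply: le_trans (iter _ _ _ Ox r0) _; rewrite ler_wpM2r// -exprMn lerXn2r ?nnegrE ?exprn_ge0//.
by lra.
Qed.

Lemma ge0_integral_cover (h : pt -> \bar R) (B : nat -> set pt) :
  measurable_fun Om h -> (forall x, Om x -> (0 <= h x)%E) ->
  (forall k, measurable (B k)) -> Om = \bigcup_k B k ->
  (\int[m]_(x in Om) h x = \sum_(k <oo) \int[m]_(x in seqDU B k) h x)%E.
Proof.
move=> mh h0 mB OB; rewrite OB seqDU_bigcup_eq in mh h0 *.
apply: ge0_integral_bigcup => //; exact: seqDU_measurable.
Qed.

(** If one ball were null, then by the growth bound so would be all concentric larger balls, and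
    these exhaust Omega. *)
Lemma wmass_dball_gt0 x r : 0 < W Om -> Om x -> 0 < r -> 0 < W (dball X x r).
Proof.
move=> W0 Ox r0; rewrite lt_neqAle wmass_ge0//; last exact: dball_Om.
rewrite andbT; apply/negP => /eqP Wr.
have [s hs] := doubling_growth.
have mk k : measurable (dball X x (k.+1%:R * r)).
  by apply: mball => //; rewrite mulr_gt0.
have Wk k : W (dball X x (k.+1%:R * r)) = 0.
  apply/eqP; rewrite eq_le wmass_ge0 ?andbT//; last exact: dball_Om.
  by apply: le_trans (hs _ _ _ Ox r0 _) _; rewrite ?ler1n// -Wr mulr0.
have OB : Om = \bigcup_k dball X x (k.+1%:R * r).
  apply/seteqP; split=> [y Oy|y [k _ []//]].
  exists (Num.bound (D x y / r)) => //; split=> //.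
  rewrite -ltr_pdivrMr//; apply: lt_trans (archi_boundP _) _; last by rewrite ltr_nat.
  by rewrite divr_ge0 ?dist_ge0// ltW.
move: W0; rewrite -lte_fin wmassE// (@ge0_integral_cover _ _ _ _ mk OB); last 2 first.
  by apply/measurable_EFinP; exact: weight_measurable.
  by move=> y Oy; rewrite lee_fin w0.
rewrite eseries0 ?ltxx// => k _ _; apply/eqP; rewrite eq_le; apply/andP; split.
  rewrite -[leRHS]/(0 : R)%:E -(Wk k) wmassE//; last exact: dball_Om.
  apply: ge0_subset_integral => //; first exact: seqDU_measurable.
    apply/measurable_EFinP; apply: measurable_funS (weight_measurable w_weight) => //.
    exact: dball_Om.
  by move=> y [Oy _]; rewrite lee_fin w0.
  exact: subset_seqDU.
by apply: integral_ge0 => y [[Oy _] _]; rewrite lee_fin w0.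
Qed.

(* A disjoint family of balls of equal radius is countable, since each of them
   has positive mass. *)
Lemma countable_cover rho : 0 < W Om -> 0 < rho ->
  exists z : nat -> pt, (forall k, Om (z k)) /\ Om = \bigcup_k dball X (z k) rho.
Proof.
move=> W0 rho0; have r0 : 0 < rho / 2 by lra.
have [x0 Ox0] : exists x, Om x.
  apply: contrapT => O0; move: W0; rewrite (_ : Om = set0) ?/wmass ?Rintegral_set0 ?ltxx//.
  by apply/seteqP; split=> // x Ox; apply: O0; exists x.
have [E [EO tE maxE]] := ex_maximal_disjoint_subcollection (fun x => dball X x (rho / 2)) Om.
have cE : countable E.
  pose Ek k := [set x | E x /\ k.+1%:R^-1 <= W (dball X x (rho / 2))].
  have -> : E = \bigcup_k Ek k.
    apply/seteqP; split=> [x Ex|x [k _ []//]].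
    have Wx := wmass_dball_gt0 W0 (EO _ Ex) r0.
    exists (Num.bound (W (dball X x (rho / 2)))^-1) => //; split=> //.
    rewrite -[leRHS]invrK lef_pV2 ?posrE ?invr_gt0 ?ltr0n//.
    by rewrite ltW// (lt_trans (archi_boundP _)) ?invr_ge0 ?(ltW Wx)// ltr_nat.
  apply: bigcup_countable => // k _; apply: finite_set_countable.
  apply: contrapT => /infiniteP/ppcard_leP[e].
  have Ee i : Ek k (e i) by exact: funS.
  have Ei i : E (e i) := (Ee i).1.
  have mF i : measurable (dball X (e i) (rho / 2)) by apply: mball => //; exact: EO.
  have tF : trivIset setT (fun i => dball X (e i) (rho / 2)).
    move=> i j _ _ /(tE _ _ (Ei i) (Ei j)); apply: 'inj_e; exact: in_setT.
  have UO : \bigcup_i dball X (e i) (rho / 2) `<=` Om by move=> x [i _ []].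
  have mw := weight_measurable w_weight.
  (* N disjoint balls, each of mass at least 1/(k+1), would exceed the total mass. *)
  pose N := Num.bound (W Om * k.+1%:R).
  have : (\sum_(0 <= i < N) (k.+1%:R^-1)%:E <= (W Om)%:E)%E.
    apply: (@le_trans _ _ (\sum_(0 <= i < N) (W (dball X (e i) (rho / 2)))%:E)%E).
      by apply: lee_sum => i _; rewrite lee_fin; have [] := Ee i.
    apply: le_trans (nneseries_lim_ge _ _) _.
      by move=> i _ _; rewrite lee_fin wmass_ge0//; exact: dball_Om.
    rewrite wmassE//.
    under eq_eseriesr => i _ do rewrite (wmassE w_weight (mF i) (@dball_Om _ _)).
    rewrite -ge0_integral_bigcup//.
    + apply: ge0_subset_integral => //; first exact: bigcup_measurable.
        exact/measurable_EFinP.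
    + by apply/measurable_EFinP; apply: measurable_funS mw.
    + by move=> x /UO Ox; rewrite lee_fin w0.
  rewrite sumEFin lee_fin big_mkord sumr_const card_ord -[leLHS]mulr_natl.
  by rewrite ler_pdivrMr ?ltr0n// leNgt archi_boundP// mulr_ge0// ltW.
(* A point at distance at least rho from all centres would have its ball of radius rho / 2 disjoint
   from the family, against maximality. *)
have cover x : Om x -> exists2 y, E y & D y x < rho.
  move=> Ox; apply: contrapT => far.
  have {}far y : E y -> rho <= D y x.
    by move=> Ey; rewrite leNgt; apply/negP => yx; apply: far; exists y.
  have nEx : ~ E x by move=> /far; rewrite distxx//; lra.
  have disj y : E y -> ~ (dball X y (rho / 2) `&` dball X x (rho / 2) !=set0).
    move=> Ey [u [[Ou yu] [_ xu]]]; have := far _ Ey.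
    have := dist_triangle (EO _ Ey) Ou Ox; rewrite (distC Ou Ox).
    by lra.
  apply: (maxE (E `|` [set x])).
  - split; first by move=> y Ey; left.
    by move=> /(_ x) h; apply: nEx; apply: h; right.
  - by move=> y [/EO//|->].
  - move=> y1 y2 [E1|->] [E2|->] //; first exact: tE.
      by move=> /(disj _ E1).
    by rewrite setIC => /(disj _ E2).
have [f injf] := countable_injP _ cE.
(* Indices that label no element of E receive the centre x0, which merely adds a redundant ball to
   the cover. *)
have /choice[z hz] : forall k, exists z, Om z /\ forall x, E x -> f x = k -> x = z.
  move=> k; have [[x [Ex fx]]|nx] := pselect (exists x, E x /\ f x = k).
    exists x; split; first exact: EO.
    by move=> y Ey fy; apply: injf; rewrite ?inE// fx.
  by exists x0; split=> // y Ey fy; exfalso; apply: nx; exists y.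
exists z; split=> [k|]; first by have [] := hz k.
apply/seteqP; split=> [x Ox|x [k _ []//]].
have [y Ey yx] := cover x Ox.
by exists (f y) => //; split=> //; have [_ /(_ _ Ey erefl) <-] := hz (f y).
Qed.

End DoublingWeight.
End Doubling.

Section NonMeasurableMonotonicity.
Import HBNNSimple.

(* In Assertion 3 the integrand involves bmass, whose measurability is not
   available; the integral of a nonnegative function is a supremum over simple
   functions below it, hence monotone without measurability. *)
Lemma ge0_le_integral_nonmeasurable (d : measure_display) (T : measurableType d)
    (R : realType) (mu : {measure set T -> \bar R}) (D : set T) (f g : T -> \bar R) :
  (forall x, D x -> (0 <= f x)%E) -> (forall x, D x -> (f x <= g x)%E) ->
  (\int[mu]_(x in D) f x <= \int[mu]_(x in D) g x)%E.
Proof.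
move=> f0 fg; have g0 x : D x -> (0 <= g x)%E.
  by move=> Dx; apply: le_trans (f0 x Dx) (fg x Dx).
rewrite !ge0_integralE//; apply: ereal_sup_le => _ [h /= hf <-].
exists h => //= x.
apply: le_trans (hf x) _; rewrite !patchE; case: ifPn => // /set_mem.
exact: fg.
Qed.

End NonMeasurableMonotonicity.

(** Used to replace the geometric mean of two ball masses, as it stands in Assertions 2 and 5, by
    the single mass in the integrand of Assertion 3. *)
Lemma inv_sqrt_le (R : realType) (G u v : R) : 0 < u -> 0 < v -> 0 <= G ->
  u ^+ 2 <= G ^+ 2 * v -> (Num.sqrt v)^-1 <= G / u.
Proof.
move=> u0 v0 G0 uv; have s0 : 0 < Num.sqrt v by rewrite sqrtr_gt0.
rewrite ler_pdivlMr// mulrC ler_pdivrMr//.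
have [u0' v0'] := (ltW u0, ltW v0).
by rewrite -(ler_pXn2r (ltn0Sn 1)) ?nnegrE ?mulr_ge0// exprMn sqr_sqrtr.
Qed.

(** * Integrals of decaying functions against a weight of polynomial growth *)

Section Growth.
Context {R : realType} {d : nat} (X : mdomain R d) (domX : is_domain X).
Local Notation pt := (euclid R d).
Local Notation Om := (Omega X).
Local Notation m := (leb X).
Local Notation D := (Defs.mdist X).

Let mOm : measurable Om := domain_measurable domX.
Let mball x r : Om x -> 0 < r -> measurable (dball X x r) :=
  @domain_dball _ _ _ domX x r.

Context (w : pt -> R) (w_weight : weight X w) (s : nat).
Local Notation W := (wmass X w).
Let w0 x : Om x -> 0 <= w x := w_weight.1 x.
Context (growth : forall x r t, Om x -> 0 < r -> 1 <= t ->
  W (dball X x (t * r)) <= 2 ^+ s * t ^+ s * W (dball X x r)).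

(** B(y, r) lies in B(x, t r) with t = 1 + d(x, y) / r. *)
Lemma wmass_shift x y r : Om x -> Om y -> 0 < r ->
  W (dball X y r) <= 2 ^+ s * (1 + D x y / r) ^+ s * W (dball X x r).
Proof.
move=> Ox Oy r0; have D0 := dist_ge0 domX Ox Oy.
have t1 : 1 <= 1 + D x y / r by rewrite lerDl divr_ge0// ltW.
apply: le_trans (growth Ox r0 t1).
apply: (le_wmass domX w_weight); [exact: mball| | |exact: dball_Om].
  by apply: mball => //; rewrite mulr_gt0// (lt_le_trans _ t1).
by apply: dball_sub => //; rewrite mulrDl mul1r mulfVK ?gt_eqF// addrC.
Qed.

Lemma measurable_decay (k : nat) z (c : R) : Om z -> 0 <= c ->
  measurable_fun Om (fun x => ((1 + D z x * c) ^+ k)^-1).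
Proof.
move=> Oz c0; apply: (eq_measurable_fun (fun x => ((1 + D z x * c) ^+ k) `^ (-1))).
  move=> x /set_mem Ox; rewrite powR_inv1// exprn_ge0// addr_ge0// mulr_ge0//.
  exact: dist_ge0.
apply: (measurableT_comp (measurable_powR (-1))).
apply: measurable_funX; apply: measurable_funD => //.
by apply: measurable_funM => //; exact: measurable_dist.
Qed.

(* Sum over the annuli 2^(k-1) r <= D z x < 2^k r. *)
Lemma decay_integral z r : Om z -> 0 < r ->
  (\int[m]_(x in Om) (((1 + D z x / r) ^+ s.+1)^-1 * w x)%:E
     <= (2 ^+ (2 * s.+1) * W (dball X z r))%:E)%E.
Proof.
move=> Oz r0; pose B k := dball X z (2 ^+ k * r).
have Br k : 0 < 2 ^+ k * r by rewrite mulr_gt0// exprn_gt0.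
have mB k : measurable (B k) by exact: mball.
have D0 x : Om x -> 0 <= D z x / r.
  by move=> Ox; apply: divr_ge0; [exact: dist_ge0|exact: ltW].
have h0 x : Om x -> 0 <= ((1 + D z x / r) ^+ s.+1)^-1.
  by move=> Ox; rewrite invr_ge0 exprn_ge0// addr_ge0// D0.
have mw := weight_measurable w_weight.
have OB : Om = \bigcup_k B k.
  apply/seteqP; split=> [x Ox|x [k _ []//]].
  have [|k [tk _]] := @pow2_bracket R (1 + D z x / r); first by rewrite lerDl D0.
  by exists k => //; split=> //; rewrite -ltr_pdivrMr//; lra.
rewrite (ge0_integral_cover _ _ mB OB); last 2 first.
- apply/measurable_EFinP; apply: measurable_funM => //.
  by apply: measurable_decay; rewrite // invr_ge0 ltW.
- by move=> x Ox; rewrite lee_fin mulr_ge0// ?h0// w0.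
have BO k x : seqDU B k x -> Om x by case=> -[].
have term k : (\int[m]_(x in seqDU B k) (((1 + D z x / r) ^+ s.+1)^-1 * w x)%:E <=
    ((2 ^+ (2 * s.+1) * W (dball X z r)) / (2 ^ (k + 1))%:R)%:E)%E.
  (* Off the smaller balls 1 + d(z, x) / r is at least 2^(k-1), hence c. The mass of B k is at most
     2^s 2^(ks) times that of B(z, r), and the product is exactly the kth term of the geometric
     series. *)
  pose c : R := (2 / 2 ^+ k) ^+ s.+1.
  have c0 : 0 <= c by rewrite exprn_ge0// divr_ge0// exprn_ge0.
  apply: (@le_trans _ _ (\int[m]_(x in seqDU B k) (c%:E * (w x)%:E))%E).
    apply: ge0_le_integral_nonmeasurable => x Bx; rewrite -?EFinM lee_fin.
      by rewrite mulr_ge0 ?h0 ?w0//; exact: BO Bx.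
    rewrite ler_wpM2r ?w0//; first exact: BO Bx.
    have Ox := BO _ _ Bx; have := D0 _ Ox => Dr.
    rewrite /c -[2 / 2 ^+ k]invf_div exprVn.
    rewrite lef_pV2 ?posrE ?exprn_gt0 ?divr_gt0 ?exprn_gt0//; last lra.
    rewrite lerXn2r ?nnegrE ?divr_ge0 ?exprn_ge0//; first lra.
    case: k Bx {c c0} => [|k] [Bx nBx]; first by rewrite expr0; lra.
    rewrite exprS mulrAC divff// mul1r.
    have /negP : ~ (D z x < 2 ^+ k * r).
      by move=> xk; apply: nBx; rewrite -bigcup_mkord; exists k => /=.
    by rewrite -leNgt -ler_pdivlMr// => ?; lra.
  have mS : measurable (seqDU B k) by exact: seqDU_measurable.
  rewrite ge0_integralZl//; last 2 first.
  - by apply/measurable_EFinP; apply: measurable_funS mw => //; exact: BO.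
  - by move=> x /BO Ox; rewrite lee_fin w0.
  apply: (@le_trans _ _ (c%:E * (W (B k))%:E)%E).
    rewrite lee_wpmul2l ?lee_fin// wmassE//; last exact: dball_Om.
    apply: ge0_subset_integral => //; last exact: subset_seqDU.
      by apply/measurable_EFinP; apply: measurable_funS mw => //; exact: dball_Om.
    by move=> x [Ox _]; rewrite lee_fin w0.
  rewrite -EFinM lee_fin; have k1 : (1 : R) <= 2 ^+ k by rewrite exprn_ege1// ler1n.
  apply: le_trans (ler_wpM2l c0 (growth Oz r0 k1)) _.
  rewrite mulrA [X in _ <= X]mulrAC ler_wpM2r//.
    by apply: wmass_ge0 => //; exact: dball_Om.
  have p2 : (2 : R) ^+ k != 0 by rewrite expf_neq0.
  have p2s : ((2 : R) ^+ k) ^+ s != 0 by rewrite expf_neq0.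
  rewrite /c exprMn exprVn natrX (exprD _ k) expr1 mul2n -addnn exprD !exprS.
  by rewrite le_eqVlt; apply/orP; left; apply/eqP; field; rewrite p2.
apply: le_trans (lee_nneseries _ (fun k _ => term k)) _.
  move=> k _ _; apply: integral_ge0 => x /BO Ox.
  by rewrite lee_fin mulr_ge0 ?h0 ?w0.
have /cvg_lim := @cvg_geometric_eseries_half R (2 ^+ (2 * s.+1) * W (dball X z r)) 0.
by rewrite expr0 divr1 => <-.
Qed.

End Growth.

(** * Localized kernels *)

Section KernelEstimates.
Context {R : realType} {d : nat} (X : mdomain R d) (domX : is_domain X).
Local Notation pt := (euclid R d).
Local Notation Om := (Omega X).
Local Notation m := (leb X).
Local Notation D := (Defs.mdist X).
Context (cOm : compact (Om : set 'rV[R]_d)).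
Context (varpi : pt -> R) (varpi_doubling : doubling_weight X varpi)
        (varpi_unit : wmass X varpi Om = 1).
Context (mu : {poly R}) (P : nat -> pt -> pt -> R)
        (P_kernel : reproducing_kernel X varpi P).
Local Notation b := (bmass X varpi).

Let mOm : measurable Om := domain_measurable domX.
Let wvarpi : weight X varpi := varpi_doubling.1.
Let varpi0 x : Om x -> 0 <= varpi x := wvarpi.1 x.

Definition sdist (n : nat) (x y : pt) : R := 1 + n%:R * D x y.

Lemma sdist_ge1 n x y : Om x -> Om y -> 1 <= sdist n x y.
Proof. by move=> Ox Oy; rewrite lerDl mulr_ge0// dist_ge0. Qed.

Lemma sdist_gt0 n x y : Om x -> Om y -> 0 < sdist n x y.
Proof. by move=> Ox Oy; apply: lt_le_trans (sdist_ge1 n Ox Oy). Qed.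

Lemma sdistC n x y : Om x -> Om y -> sdist n x y = sdist n y x.
Proof. by move=> Ox Oy; rewrite /sdist distC. Qed.

Lemma sdist_triangle n y x z : Om x -> Om y -> Om z ->
  sdist n x z <= sdist n x y * sdist n y z.
Proof.
move=> Ox Oy Oz; rewrite /sdist.
have h1 := ler_wpM2l (ler0n R n) (dist_triangle domX Ox Oy Oz).
have h2 : 0 <= n%:R * D x y * (n%:R * D y z) by rewrite !mulr_ge0// dist_ge0.
nra.
Qed.

Lemma decayE n (k : nat) x y : Om x -> Om y ->
  decay X n k%:R x y = (sdist n x y ^+ k)^-1.
Proof.
by move=> Ox Oy; rewrite /decay powRN powR_mulrn// ltW// sdist_gt0.
Qed.

Lemma bmass_gt0 n x : (0 < n)%N -> Om x -> 0 < b n x.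
Proof.
move=> n0 Ox; apply: wmass_dball_gt0 => //; first by rewrite varpi_unit.
by rewrite invr_gt0 ltr0n.
Qed.

Lemma bmass_shift : exists s : nat, forall n x y, (0 < n)%N -> Om x -> Om y ->
  b n y <= 2 ^+ s * sdist n x y ^+ s * b n x.
Proof.
have [s hs] := doubling_growth domX varpi_doubling.
exists s => n x y n0 Ox Oy.
have ni : (0 : R) < n%:R^-1 by rewrite invr_gt0 ltr0n.
have := wmass_shift domX wvarpi hs Ox Oy ni.
by rewrite invrK (mulrC (D x y)).
Qed.

(** The common part of the bounds for g x and for f z - f y. The [beta] extra powers of decay in K
    compensate the growth allowed to f, and the other [k0] keep the integral bounded; [C] does not
    depend on [beta]. *)
Lemma kernel_bound : Assertion3 X varpi -> exists k0 : nat, (0 < k0)%N /\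
  exists2 C : R, 0 < C & forall (beta n : nat) x (A F : R) f K, (0 < n)%N -> Om x ->
  0 <= A -> 0 <= F -> polyfun X f -> polyfun X K ->
  (forall y, Om y -> `|f y| <= F * sdist n x y ^+ beta) ->
  (forall y, Om y -> `|K y| <= A / b n y / sdist n x y ^+ (k0 + beta)) ->
  `|inner X varpi f K| <= C * (A * F).
Proof.
move=> [kappa0 H3]; pose k0 := (Num.bound `|kappa0|).+1.
have k00 : (0 : R) < k0%:R by rewrite ltr0n.
have kk0 : kappa0 <= k0%:R.
  apply: le_trans (ler_norm _) _; apply: le_trans (ltW (archi_boundP _)) _ => //.
  by rewrite ler_nat.
have [c hc] := H3 _ k00 kk0.
exists k0; split=> //; exists (`|c| + 1) => [|beta n x A F f K n0 Ox A0 F0 pf pK hf hK].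
  by rewrite ltr_wpDl.
have tt0 y : Om y -> 0 < sdist n x y by move=> Oy; exact: sdist_gt0.
have b0 y : Om y -> 0 < b n y by move=> Oy; exact: bmass_gt0.
have fK y : Om y -> `|f y * K y * varpi y| <=
    A * F * (varpi y / b n y * (sdist n x y ^+ k0)^-1).
  move=> Oy; rewrite !normrM (ger0_norm (varpi0 Oy)).
  have -> : A * F * (varpi y / b n y / sdist n x y ^+ k0) =
      (F * sdist n x y ^+ beta) * (A / b n y / sdist n x y ^+ (k0 + beta)) * varpi y.
    rewrite exprD; field.
    by rewrite !gt_eqF ?exprn_gt0 ?tt0 ?b0.
  by rewrite ler_wpM2r ?varpi0// ler_pM// ?hf ?hK.
(* Below, A * F is divided out on the side of the measurable integrand, so as not to pull it out of
   the integral in Assertion 3; hence the separate case. *)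
have [AF0|AF0] := eqVneq (A * F) 0.
  rewrite AF0 mulr0 normr_le0; apply/eqP; rewrite -(inner0 mOm varpi (cst 0)).
  apply: eq_Rintegral => y /set_mem Oy; apply/eqP.
  by rewrite /= !mul0r -normr_le0 (le_trans (fK y Oy))// AF0 mul0r.
have AFp : 0 < A * F by rewrite lt_neqAle eq_sym AF0 mulr_ge0.
have iK := inner_integrable mOm cOm wvarpi pf pK.
apply: le_trans (le_normr_Rintegral mOm iK) _.
have mK : measurable_fun Om (fun y => `|f y * K y * varpi y|).
  by apply: measurableT_comp => //; apply/measurable_EFinP; exact: measurable_int iK.
rewrite mulrC -ler_pdivrMl//.
have inorm : m.-integrable Om (EFin \o (fun y => `|f y * K y * varpi y|)).
  by have := integrable_norm iK; apply: eq_integrable.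
rewrite -RintegralZl// -lee_fin /Rintegral fineK; last first.
  apply: integrable_fin_num => //.
  have := integrableZl mOm (A * F)^-1 inorm; apply: eq_integrable => //.
apply: (@le_trans _ _ c%:E); last by rewrite lee_fin (le_trans (ler_norm c))// lerDl.
apply: le_trans (hc n x n0 Ox); apply: ge0_le_integral_nonmeasurable => y Oy.
  by rewrite lee_fin mulr_ge0// invr_ge0 ltW.
rewrite lee_fin decayE// mulrC ler_pdivrMr// [leRHS]mulrC.
exact: fK.
Qed.

Lemma Lker_frac_polyfun a r n x : Om x -> polyfun X (Lker_frac mu P a r n x).
Proof.
move=> Ox.
exact: (kernel_sum_polyfun P_kernel (2 * n).+1
  (fun k => a (k%:R / n%:R) * mu.[k%:R] `^ (r / 2)) Ox).
Qed.

Lemma frac_bound r : 0 < r -> Assertion3 X varpi -> Assertion5 X varpi mu P ->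
  forall beta : nat, exists2 C : R, 0 < C & forall (n : nat) f g x (F : R),
  (0 < n)%N -> poly_on X n f -> is_fractional_power X varpi mu r f g -> Om x ->
  0 <= F -> (forall y, Om y -> `|f y| <= F * sdist n x y ^+ beta) ->
  `|g x| <= C * (n%:R `^ r * F).
Proof.
move=> r0 H3 H5 beta; have [k0 [k00 [C C0 hC]]] := kernel_bound H3.
have [s hs] := bmass_shift; have [a [adm a1]] := @exists_cutoff R.
(* The s further powers pay for passing from the ball at x to the ball at y. *)
have kp : (0 : R) < (k0 + beta + s)%:R by rewrite ltr0n !addn_gt0 k00.
have [c hc] := H5 a adm r _ r0 kp.
exists (C * ((`|c| + 1) * 2 ^+ s)); first by rewrite mulr_gt0// mulr_gt0 ?exprn_gt0// ltr_wpDl.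
move=> n f g x F n0 pf fg Ox F0 hF.
rewrite (Lker_frac_reproduces mOm cOm wvarpi P_kernel a1 n0 pf fg Ox).
have nr0 : 0 <= n%:R `^ r :> R by exact: powR_ge0.
have -> : C * ((`|c| + 1) * 2 ^+ s) * (n%:R `^ r * F) =
    C * ((`|c| + 1) * n%:R `^ r * 2 ^+ s * F) by ring.
apply: (hC beta n x) => //.
- by exists n.
- exact: Lker_frac_polyfun.
move=> y Oy; apply: le_trans (hc n x y n0 Ox Oy) _.
have bx := bmass_gt0 n0 Ox; have by_ := bmass_gt0 n0 Oy.
have t0 := sdist_gt0 n Ox Oy; have t1 := sdist_ge1 n Ox Oy.
have hsq : (Num.sqrt (b n x * b n y))^-1 <= 2 ^+ s * sdist n x y ^+ s / b n y.
  apply: inv_sqrt_le; rewrite ?mulr_gt0 ?mulr_ge0 ?exprn_ge0 ?(ltW t0)//.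
  have G1 : 1 <= 2 ^+ s * sdist n x y ^+ s.
    by rewrite -exprMn exprn_ege1//; lra.
  rewrite expr2 [X in _ <= X]mulrA ler_pM2r//; apply: le_trans (hs n x y n0 Ox Oy) _.
  by rewrite ler_pM2r// expr2 ler_peMl//; lra.
rewrite decayE//.
have -> : (`|c| + 1) * n%:R `^ r * 2 ^+ s / b n y / sdist n x y ^+ (k0 + beta) =
   (`|c| + 1) * n%:R `^ r * (2 ^+ s * sdist n x y ^+ s / b n y)
     / sdist n x y ^+ (k0 + beta + s).
  by rewrite (exprD _ _ s); field; rewrite !gt_eqF ?exprn_gt0.
rewrite ler_wpM2r ?invr_ge0 ?exprn_ge0 ?(ltW t0)//.
apply: le_trans (ler_wpM2l _ hsq); last by rewrite mulr_ge0// addr_ge0.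
rewrite ler_wpM2r ?invr_ge0 ?sqrtr_ge0// ler_wpM2r//.
by rewrite (le_trans (ler_norm c))// lerDl.
Qed.

(** By the triangle inequality, near maximality at y makes |f u| at most 2 |f y| (1 + n d(y,
    u))^beta. The growth of f is thus measured by |f y| itself, which is why its oscillation near y
    can be compared with |f y|. The scale [delta] is uniform in f, n and x. *)
Lemma near_maximum : Assertion2 X varpi P -> Assertion3 X varpi ->
  forall beta : nat, exists2 delta : R, 0 < delta <= 1 & forall n f x,
  (0 < n)%N -> poly_on X n f -> Om x -> exists y, [/\ Om y,
    forall u, Om u -> `|f u| <= 2 * `|f y| / sdist n x y ^+ beta * sdist n x u ^+ beta
  & forall z, dball X y (delta / n%:R) z -> `|f y| <= 2 * `|f z| ].
Proof.
move=> H2 H3 beta; have [k0 [k00 [C C0 hC]]] := kernel_bound H3.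
have [s hs] := bmass_shift; have [a [adm a1]] := @exists_cutoff R.
have kp : (0 : R) < (k0 + beta + s)%:R by rewrite ltr0n !addn_gt0 k00.
have [delta0 [/andP[d00 d01] /(_ _ kp)[c hc]]] := H2 a adm.
pose c' : R := `|c| + 1.
have c'0 : 0 < c' by rewrite ltr_wpDl.
(* The bound [key] amounts to |f z - f y| <= (B - 1) n d(z, y) |f y| / 2, so n d(z, y) <= delta0 / B
   suffices; the summand 1 keeps B > 1. *)
pose B : R := 4 * C * c' * 8 ^+ s + 1.
have B1 : 1 < B by rewrite ltrDr !mulr_gt0 ?exprn_gt0.
have B0 : 0 < B by lra.
exists (delta0 / B); first by rewrite divr_gt0//= ler_pdivrMr//; lra.
move=> n f x n0 pf Ox.
have n0' : (0 : R) < n%:R by rewrite ltr0n.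
have [M M0 hM] := poly_on_bounded cOm pf.
pose h u := `|f u| / sdist n x u ^+ beta.
have h0 u : Om u -> 0 <= h u.
  by move=> Ou; rewrite divr_ge0// exprn_ge0// ltW// sdist_gt0.
have fh u : Om u -> `|f u| = h u * sdist n x u ^+ beta.
  by move=> Ou; rewrite /h divfK// expf_neq0// gt_eqF// sdist_gt0.
have [y [Oy hy]] : exists y, Om y /\ forall u, Om u -> h u <= 2 * h y.
  (* A point within half the supremum requires the supremum to be positive; if h vanishes on Omega,
     x itself serves. *)
  have [u0|/asboolPn] := pselect (forall u, Om u -> h u <= 0).
    by exists x; split=> // u Ou; rewrite (le_trans (u0 u Ou))// mulr_ge0// h0.
  move=> /existsp_asboolPn[u] /asboolPn/imply_asboolPn [Ou /negP]; rewrite -ltNge => hu.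
  pose S := [set h v | v in Om].
  have supS : has_sup S.
    split; first by exists (h u), u.
    exists M => _ [v Ov <-]; apply: le_trans (hM v Ov).
    by rewrite ler_piMr// invf_le1 ?exprn_gt0 ?sdist_gt0// exprn_ege1// sdist_ge1.
  have hS v : Om v -> h v <= sup S.
    by move=> Ov; apply: sup_upper_bound => //; exists v.
  have S0 : 0 < sup S / 2 by rewrite divr_gt0// (lt_le_trans hu)// hS.
  have [_ [y Oy <-] ylt] := sup_adherent S0 supS.
  exists y; split=> // v Ov; apply: le_trans (hS v Ov) _; lra.
have fy u : Om u -> `|f u| <= 2 * `|f y| / sdist n x y ^+ beta * sdist n x u ^+ beta.
  move=> Ou; rewrite fh// -(mulrA 2) -/(h y) ler_wpM2r ?hy//.
  by rewrite exprn_ge0// ltW// sdist_gt0.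
exists y; split=> // z [Oz yz].
have yz1 : n%:R * D z y <= delta0 / B.
  by rewrite mulrC -ler_pdivlMr// distC// ltW.
have dB1 : delta0 / B <= 1 by rewrite ler_pdivrMr//; lra.
have Fy u : Om u -> `|f u| <= 2 * `|f y| * sdist n y u ^+ beta.
  move=> Ou; apply: le_trans (fy u Ou) _.
  rewrite -mulrA ler_wpM2l ?mulr_ge0// mulrC ler_pdivrMr ?exprn_gt0 ?sdist_gt0//.
  by rewrite -exprMn lerXn2r ?nnegrE ?mulr_ge0 ?(ltW (sdist_gt0 _ _ _))// mulrC sdist_triangle.
have pL u : Om u -> polyfun X (Lker P a n u).
  by move=> Ou; exact: (kernel_sum_polyfun P_kernel (2 * n).+1 (fun k => a (k%:R / n%:R)) Ou).
have pf' : polyfun X f by exists n.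
have key : `|f z - f y| <= C * ((c' * (n%:R * D z y) * 8 ^+ s) * (2 * `|f y|)).
  have -> : f z - f y = inner X varpi f (fun u => Lker P a n z u - Lker P a n y u).
    rewrite innerC (inner_sub mOm cOm wvarpi (pL _ Oz) (pL _ Oy) pf').
    by rewrite -!(innerC X varpi f) -!(Lker_reproduces mOm cOm wvarpi P_kernel a1 n0 pf).
  apply: (hC beta n y) => //.
  - by rewrite !mulr_ge0 ?exprn_ge0 ?dist_ge0// ltW.
  - by apply: polyfun_sub; exact: pL.
  move=> u Ou.
  have dd : 0 < delta0 <= delta0 by rewrite d00/=.
  have zB : dball X y (delta0 / n%:R) z.
    split=> //; apply: lt_le_trans yz _; rewrite ler_wpM2r ?invr_ge0//.
    by rewrite ler_pdivrMr// ler_peMr// ltW.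
  apply: le_trans (hc delta0 n z y u dd n0 Oy zB Ou) _.
  have bz := bmass_gt0 n0 Oz; have by_ := bmass_gt0 n0 Oy; have bu := bmass_gt0 n0 Ou.
  have t0 := sdist_gt0 n Oy Ou; have t1 := sdist_ge1 n Oy Ou.
  have hbu := hs n y u n0 Oy Ou.
  have hby : b n y <= 4 ^+ s * b n z.
    apply: le_trans (hs n z y n0 Oz Oy) _; rewrite ler_pM2r// -exprMn.
    have := sdist_ge1 n Oz Oy; rewrite /sdist => h1.
    by rewrite lerXn2r ?nnegrE//; lra.
  (* 8 = 2 * 4: the factor 2^s moves the ball from y to u, and 4^s compares y with z, where 1 + n
     d(z, y) <= 2. *)
  have hsq : (Num.sqrt (b n z * b n y))^-1 <= 8 ^+ s * sdist n y u ^+ s / b n u.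
    apply: inv_sqrt_le; rewrite ?mulr_gt0 ?mulr_ge0 ?exprn_ge0 ?(ltW t0)//.
    have E8 : (8 : R) ^+ s = 4 ^+ s * 2 ^+ s by rewrite -exprMn; congr (_ ^+ _); ring.
    have p1 : (1 : R) <= 4 ^+ s by rewrite exprn_ege1// ler1n.
    set T := sdist n y u ^+ s in hbu *; have T0 : 0 < T by rewrite exprn_gt0.
    set p := (2 : R) ^+ s in hbu E8 *; have p0 : 0 < p by rewrite exprn_gt0.
    set q := (4 : R) ^+ s in hby E8 p1 *.
    apply: (@le_trans _ _ ((p * T * b n y) ^+ 2)).
      by rewrite lerXn2r ?nnegrE ?mulr_ge0 ?(ltW T0) ?(ltW p0) ?(ltW by_) ?(ltW bu).
    rewrite E8 (_ : (p * T * b n y) ^+ 2 = (p * T) ^+ 2 * b n y * b n y); last by ring.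
    rewrite (_ : _ * (b n z * b n y) = (p * T) ^+ 2 * (q * (q * b n z)) * b n y); last by ring.
    rewrite ler_wpM2r ?(ltW by_)// ler_wpM2l ?sqr_ge0//.
    by apply: le_trans hby _; rewrite ler_peMl// mulr_ge0 ?(ltW bz)//; lra.
  rewrite decayE//.
  have -> : c' * (n%:R * D z y) * 8 ^+ s / b n u / sdist n y u ^+ (k0 + beta) =
     c' * (n%:R * D z y) * (8 ^+ s * sdist n y u ^+ s / b n u) / sdist n y u ^+ (k0 + beta + s).
    by rewrite (exprD _ _ s); field; rewrite !gt_eqF ?exprn_gt0.
  rewrite ler_wpM2r ?invr_ge0 ?exprn_ge0 ?(ltW t0)//.
  have nD0 : 0 <= n%:R * D z y by rewrite mulr_ge0// dist_ge0.
  apply: le_trans (ler_wpM2l _ hsq); last by rewrite mulr_ge0// ltW.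
  rewrite -(mulrA c) ler_wpM2r ?invr_ge0 ?sqrtr_ge0// ler_wpM2r//.
  by rewrite (le_trans (ler_norm c))// lerDl.
have {}key : `|f z - f y| <= `|f y| / 2.
  apply: le_trans key _.
  rewrite (_ : C * _ = (4 * C * c' * 8 ^+ s) * (n%:R * D z y) * (`|f y| / 2)); last by field.
  rewrite -[leRHS]mul1r ler_wpM2r ?divr_ge0//.
  have yB : n%:R * D z y * B <= delta0 by rewrite -ler_pdivlMr.
  have nD0 : 0 <= n%:R * D z y by rewrite mulr_ge0// dist_ge0.
  have -> : 4 * C * c' * 8 ^+ s = B - 1 by rewrite /B addrK.
  by lra.
have := ler_distD (f z) (f y) 0; rewrite !subr0 distrC.
by lra.
Qed.

End KernelEstimates.

(** * The weighted norms *)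

Section WeightedSum.
Context {R : realType} {d : nat} (X : mdomain R d) (domX : is_domain X).
Local Notation pt := (euclid R d).
Local Notation Om := (Omega X).
Local Notation m := (leb X).
Local Notation D := (Defs.mdist X).
Context (w : pt -> R) (w_weight : weight X w) (s : nat).
Local Notation W := (wmass X w).
Context (Wball : forall x r, Om x -> 0 < r -> 0 < W (dball X x r)).
Context (growth : forall x r t, Om x -> 0 < r -> 1 <= t ->
  W (dball X x (t * r)) <= 2 ^+ s * t ^+ s * W (dball X x r)).

Let mOm : measurable Om := domain_measurable domX.
Let mball x r : Om x -> 0 < r -> measurable (dball X x r) :=
  @domain_dball _ _ _ domX x r.
Let w0 x : Om x -> 0 <= w x := w_weight.1 x.
Let mw : measurable_fun Om w := weight_measurable w_weight.

Context (delta : R) (delta01 : 0 < delta <= 1) (n : nat) (n0 : (0 < n)%N).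
Let rho := delta / n%:R.
Context (z : nat -> pt) (Oz : forall k, Om (z k))
        (Oz_cover : Om = \bigcup_k dball X (z k) rho).
Local Notation E := (seqDU (fun k => dball X (z k) rho)).

Let n0' : (0 : R) < n%:R. Proof. by rewrite ltr0n. Qed.
Let ni0 : (0 : R) < n%:R^-1. Proof. by rewrite invr_gt0. Qed.
Let d0 : 0 < delta. Proof. by case/andP: delta01. Qed.
Let d1 : delta <= 1. Proof. by case/andP: delta01. Qed.
Let rho0 : 0 < rho. Proof. by rewrite divr_gt0. Qed.
Let nrho : n%:R * rho = delta. Proof. by rewrite mulrC divfK// gt_eqF. Qed.
Let mE k : measurable (E k).
Proof. by apply: seqDU_measurable => j; exact: mball. Qed.
Let EO k : E k `<=` Om. Proof. by move=> x [[]]. Qed.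

Context (phi : pt -> R) (phi0 : forall x, Om x -> 0 <= phi x)
        (mphi : measurable_fun Om phi).
Let phi0E x : Om x -> (0 <= (phi x)%:E)%E. Proof. by rewrite lee_fin; exact: phi0. Qed.

(** The divisor is the mass of the ball of radius 1/n rather than of the cell, which may be empty;
    it is also the mass that [decay_integral] produces. *)
Definition cell_average (k : nat) : \bar R :=
  ((W (dball X (z k) n%:R^-1))^-1%:E * \int[m]_(x in E k) (phi x)%:E)%E.

Lemma cell_average_ge0 k : (0 <= cell_average k)%E.
Proof.
apply: mule_ge0; first by rewrite lee_fin invr_ge0 ltW// Wball.
by apply: integral_ge0 => x /EO; exact: phi0E.
Qed.

(* When the cell E_k meets B(y, delta / n), the first factor compares
   1 + n d(x, z_k) with 1 + n d(x, y), and the second w(B(z_k, 1/n)) with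
   w(B(y, delta / n)). *)
Definition spread : R := 3 ^+ s.+1 * (2 ^+ s * (3 / delta) ^+ s).

Lemma spread_gt0 : 0 < spread.
Proof. by rewrite !mulr_gt0 ?exprn_gt0 ?divr_gt0. Qed.

(** Each cell meeting the ball is dominated by its own term of the series, and the other terms are
    nonnegative. Outside the prefactor the right-hand side no longer contains y. *)
Lemma ball_integral_le x y : Om x -> Om y ->
  (\int[m]_(u in dball X y rho) (phi u)%:E <=
   (spread * sdist X n x y ^+ s.+1 * W (dball X y rho))%:E *
   \sum_(k <oo) ((sdist X n (z k) x ^+ s.+1)^-1)%:E * cell_average k)%E.
Proof.
move=> Ox Oy; have Wy := Wball Oy rho0.
have c0 : 0 <= spread * sdist X n x y ^+ s.+1 * W (dball X y rho).
  apply/ltW/mulr_gt0 => //; apply: mulr_gt0; first exact: spread_gt0.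
  by rewrite exprn_gt0// sdist_gt0.
have tz k : 0 < sdist X n (z k) x by exact: sdist_gt0.
have mEy k : measurable (dball X y rho `&` E k) by apply: measurableI => //; exact: mball.
rewrite -nneseriesZl; last first.
  by move=> k _; rewrite mule_ge0 ?cell_average_ge0// lee_fin invr_ge0 exprn_ge0// ltW.
rewrite [X in integral _ X](_ : _ = \bigcup_k (dball X y rho `&` E k)); last first.
  by rewrite -setI_bigcupr -seqDU_bigcup_eq -Oz_cover; apply/esym/setIidPl; exact: dball_Om.
rewrite ge0_integral_bigcup//; last 3 first.
- by apply/measurable_EFinP; apply: measurable_funS mphi => // u [k _ [[]]].
- by move=> u [k _ [[Ou _] _]]; exact: phi0E.
- by apply: trivIset_setIl; exact: trivIset_seqDU.
apply: lee_nneseries => [k _ _|k _].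
  by apply: integral_ge0 => u [[Ou _] _]; exact: phi0E.
have [->|/set0P[u [[Ou yu] [[_ zu] _]]]] := eqVneq (dball X y rho `&` E k) set0.
  rewrite integral_set0; apply: mule_ge0; first by rewrite lee_fin.
  by apply: mule_ge0; [rewrite lee_fin invr_ge0 exprn_ge0// ltW|exact: cell_average_ge0].
(* Source of both 3s in [spread]: as rho <= 1/n, B(z_k, 1/n) lies in B(y, 3/n), and 1 + n d(z_k, y)
   <= 3. *)
have yz : D y (z k) < 2 * rho.
  have := dist_triangle domX Oy Ou (Oz k); rewrite (distC domX Ou)//; lra.
apply: (@le_trans _ _ (\int[m]_(v in E k) (phi v)%:E)%E).
  apply: ge0_subset_integral => //.
    by apply/measurable_EFinP; apply: measurable_funS mphi.
  by move=> v /EO; exact: phi0E.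
set I := (\int[m]_(v in E k) _)%E.
have I0 : (0 <= I)%E by apply: integral_ge0 => v /EO; exact: phi0E.
rewrite /cell_average -/I 2!muleA -!EFinM -[leLHS]mul1e lee_wpmul2r// lee_fin.
have Wz := Wball (Oz k) ni0.
rewrite ler_pdivlMr// mul1r.
have hW : W (dball X (z k) n%:R^-1) <= 2 ^+ s * (3 / delta) ^+ s * W (dball X y rho).
  have d3 : 1 <= 3 / delta by rewrite ler_pdivlMr// mul1r; have := d1; lra.
  apply: le_trans (growth Oy rho0 d3).
  have E3 : 3 / delta * rho = 3 * n%:R^-1 by rewrite /rho mulrA divfK// gt_eqF.
  apply: (le_wmass domX w_weight); [exact: mball| | |exact: dball_Om].
    by rewrite E3; apply: mball => //; rewrite mulr_gt0.
  apply: dball_sub => //; rewrite E3.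
  have : rho <= n%:R^-1 by rewrite ler_piMl// ltW.
  by lra.
have ht : sdist X n (z k) x <= 3 * sdist X n x y.
  apply: le_trans (sdist_triangle domX n (Oz k) Oy Ox) _.
  rewrite (sdistC domX n Oy Ox) ler_pM2r; last exact: sdist_gt0.
  have := ler_wpM2l (ltW n0') (ltW yz); rewrite mulrCA nrho (distC domX Oy (Oz k)) /sdist.
  by have := d1; lra.
rewrite ler_pdivlMr ?exprn_gt0// mulrC.
rewrite (_ : spread * _ * _ = (3 * sdist X n x y) ^+ s.+1 *
  (2 ^+ s * (3 / delta) ^+ s * W (dball X y rho))); last first.
  by rewrite /spread (exprMn s.+1); ring.
apply: ler_pM => //; [by rewrite exprn_ge0// ltW|exact: ltW|].
by rewrite lerXn2r ?nnegrE ?mulr_ge0 ?(ltW (tz k)) ?(ltW (sdist_gt0 domX n Ox Oy)).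
Qed.

(** After exchanging sum and integral, [decay_integral] at z_k yields the mass of B(z_k, 1/n), which
    cancels the divisor in [cell_average]; the integrals of phi over the disjoint cells then add
    up. *)
Lemma integral_cell_average_le (K : R) : 0 <= K ->
  (\int[m]_(x in Om) ((K * w x)%:E *
     \sum_(k <oo) ((sdist X n (z k) x ^+ s.+1)^-1)%:E * cell_average k) <=
   (K * 2 ^+ (2 * s.+1))%:E * \int[m]_(x in Om) (phi x)%:E)%E.
Proof.
move=> K0.
have h0 k x : Om x -> 0 <= (sdist X n (z k) x ^+ s.+1)^-1.
  by move=> Ox; rewrite invr_ge0 exprn_ge0// ltW// sdist_gt0.
have ttE k x : sdist X n (z k) x = 1 + D (z k) x / n%:R^-1 by rewrite invrK mulrC.
have mh k : measurable_fun Om (fun x => (sdist X n (z k) x ^+ s.+1)^-1 * w x).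
  apply: measurable_funM => //.
  have := measurable_decay domX s.+1 (Oz k) (ltW n0').
  by apply: eq_measurable_fun => x _; rewrite /sdist mulrC.
pose u k x := (K%:E * cell_average k * ((sdist X n (z k) x ^+ s.+1)^-1 * w x)%:E)%E.
rewrite (@eq_integral _ _ _ _ _ (fun x => \sum_(k <oo) u k x)%E); last first.
  move=> x /set_mem Ox; rewrite -nneseriesZl; last first.
    by move=> k _; rewrite mule_ge0 ?cell_average_ge0// lee_fin h0.
  apply: eq_eseriesr => k _; rewrite /u !EFinM -!muleA; congr (K%:E * _)%E.
  by rewrite muleC -muleA muleCA /cell_average -!muleA.
have Ka k : (0 <= K%:E * cell_average k)%E by rewrite mule_ge0 ?cell_average_ge0.
rewrite integral_nneseries//; last 2 first.
- by move=> k; apply: measurable_funeM; exact/measurable_EFinP.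
- by move=> k x Ox; rewrite mule_ge0// lee_fin mulr_ge0 ?h0 ?w0.
rewrite (ge0_integral_cover _ phi0E _ Oz_cover); last by move=> k; exact: mball.
  2: exact/measurable_EFinP.
rewrite -nneseriesZl; last by move=> k _; apply: integral_ge0 => x /EO; exact: phi0E.
apply: lee_nneseries => [k _ _|k _].
  by apply: integral_ge0 => x Ox; rewrite mule_ge0// lee_fin mulr_ge0 ?h0 ?w0.
rewrite ge0_integralZl//; last 2 first.
- exact/measurable_EFinP.
- by move=> x Ox; rewrite lee_fin mulr_ge0 ?h0 ?w0.
have hI := decay_integral domX w_weight growth (Oz k) ni0.
apply: (@le_trans _ _ (K%:E * cell_average k *
    (2 ^+ (2 * s.+1) * W (dball X (z k) n%:R^-1))%:E)%E).
  by rewrite lee_wpmul2l//; under eq_integral do rewrite ttE.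
have Wz := Wball (Oz k) ni0.
rewrite /cell_average -!muleA (muleC (\int[m]_(_ in _) _)%E) !muleA -!EFinM.
rewrite le_eqVlt; apply/orP; left; apply/eqP; congr (_%:E * _)%E.
by field; rewrite gt_eqF.
Qed.

End WeightedSum.

(** Allows the decay exponent s + 1 to serve for all q >= 1. *)
Lemma powR_ge_inv (R : realType) (T q : R) : 1 <= T -> 1 <= q -> T^-1 `^ q <= T^-1.
Proof.
move=> T1 q1; have T0 : 0 < T by lra.
rewrite -powR_inv1 ?(ltW T0)// -powRrM mulrC powRrM powR_inv1 ?powR_ge0//.
by rewrite powR_inv1 ?(ltW T0)// lef_pV2 ?posrE ?powR_gt0// le1r_powR.
Qed.

(** * The Bernstein inequality in the uniform and the integral norms *)

Section Bernstein.
Context {R : realType} {d : nat} (X : mdomain R d) (domX : is_domain X).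
Local Notation pt := (euclid R d).
Local Notation Om := (Omega X).
Local Notation m := (leb X).
Local Notation D := (Defs.mdist X).
Context (cOm : compact (Om : set 'rV[R]_d)).
Context (varpi : pt -> R) (varpi_doubling : doubling_weight X varpi)
        (varpi_unit : wmass X varpi Om = 1).
Context (mu : {poly R}) (P : nat -> pt -> pt -> R)
        (P_kernel : reproducing_kernel X varpi P).
Context (H2 : Assertion2 X varpi P) (H3 : Assertion3 X varpi)
        (H5 : Assertion5 X varpi mu P).
Context (w : pt -> R) (w_doubling : doubling_weight X w) (r : R) (r_gt0 : 0 < r).
Local Notation W := (wmass X w).

Let mOm : measurable Om := domain_measurable domX.
Let mball x rr : Om x -> 0 < rr -> measurable (dball X x rr) :=
  @domain_dball _ _ _ domX x rr.
Let w_weight : weight X w := w_doubling.1.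
Let w0 x : Om x -> 0 <= w x := w_weight.1 x.
Let mw : measurable_fun Om w := weight_measurable w_weight.

Lemma bernstein_uniform : exists c : R, forall (n : nat) (f g : pt -> R),
  (0 < n)%N -> poly_on X n f -> is_fractional_power X varpi mu r f g ->
  (wnorm X w +oo g <= (c * n%:R `^ r)%:E * wnorm X w +oo f)%E.
Proof.
have [C C0 hC] := frac_bound domX cOm varpi_doubling varpi_unit P_kernel r_gt0 H3 H5 0.
exists C => n f g n0 pf fg; rewrite /wnorm.
have [M M0 hM] := poly_on_bounded cOm pf.
have C'0 : 0 <= C * n%:R `^ r by rewrite mulr_ge0 ?powR_ge0 ?ltW.
apply: ge_ereal_sup => _ [x Ox <-].
set S := ereal_sup _.
have fS u : Om u -> (`|f u|%:E <= S)%E by move=> Ou; apply: ereal_sup_ubound; exists u.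
have Sfin : S \is a fin_num.
  rewrite ge0_fin_numE; last by apply: le_trans (fS x Ox); rewrite lee_fin.
  apply: (@le_lt_trans _ _ M%:E); last exact: ltry.
  by apply: ge_ereal_sup => _ [u Ou <-]; rewrite lee_fin hM.
rewrite -(fineK Sfin) -EFinM lee_fin -mulrA.
apply: (hC n f g x) => //.
  by rewrite -lee_fin fineK// (le_trans _ (fS x Ox))// lee_fin.
by move=> u Ou; rewrite expr0 mulr1 -lee_fin fineK// fS.
Qed.

Lemma measurable_powR_norm k f q : poly_on X k f ->
  measurable_fun Om (fun x => `|f x| `^ q).
Proof.
move=> pf; apply: (measurableT_comp (measurable_powR q)).
by apply: measurableT_comp => //; exact: poly_on_measurable pf.
Qed.

(** Settles weights of total mass zero, where dividing by ball masses is impossible. *)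
Lemma wnorm_null q f : 0 < q -> W Om = 0 -> (exists k, poly_on X k f) ->
  wnorm X w q%:E f = 0%E.
Proof.
move=> q0 W0 [k pf]; have [M M0 hM] := poly_on_bounded cOm pf.
have -> : wnorm X w q%:E f = (0 `^ q^-1)%E; last first.
  by rewrite poweR0r// invr_eq0 gt_eqF.
congr (_ `^ _)%E; apply/eqP; rewrite eq_le; apply/andP; split; last first.
  by apply: integral_ge0 => x Ox; rewrite lee_fin mulr_ge0 ?powR_ge0 ?w0.
apply: (@le_trans _ _ (\int[m]_(x in Om) ((M `^ q)%:E * (w x)%:E))%E).
  apply: ge0_le_integral_nonmeasurable => x Ox; rewrite -?EFinM lee_fin.
    by rewrite mulr_ge0 ?powR_ge0 ?w0.
  by rewrite ler_wpM2r ?w0// ge0_ler_powR ?nnegrE ?hM// ltW.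
rewrite ge0_integralZl_EFin ?powR_ge0//; last exact/measurable_EFinP.
by rewrite -(wmassE domX w_weight mOm)// W0 mule0.
Qed.

Lemma bernstein_integral q : 1 <= q -> exists c : R, forall (n : nat) (f g : pt -> R),
  (0 < n)%N -> poly_on X n f -> is_fractional_power X varpi mu r f g ->
  (wnorm X w q%:E g <= (c * n%:R `^ r)%:E * wnorm X w q%:E f)%E.
Proof.
move=> q1; have q0 : 0 < q by lra.
have [W0|W0] := eqVneq (W Om) 0.
  exists 0 => n f g n0 pf fg; rewrite mul0r mul0e wnorm_null//.
  exact: fg.1.
have {}W0 : 0 < W Om by rewrite lt_neqAle eq_sym W0 wmass_ge0.
have [s growth] := doubling_growth domX w_doubling.
have Wball := wmass_dball_gt0 domX w_doubling W0.
(* The exponent s + 1 comes from the growth of [w], not of [varpi], since the decay is later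
   integrated against [w]. *)
have [delta delta01 near] :=
  near_maximum domX cOm varpi_doubling varpi_unit P_kernel H2 H3 s.+1.
have [C C0 hC] := frac_bound domX cOm varpi_doubling varpi_unit P_kernel r_gt0 H3 H5 s.+1.
have d0 : 0 < delta by case/andP: delta01.
pose c1 := spread s delta; have c10 : 0 < c1 by exact: spread_gt0.
pose c2 : R := c1 * 2 ^+ (2 * s.+1).
have c20 : 0 < c2 by rewrite mulr_gt0// exprn_gt0.
(* One factor 2 is the near maximality of y, the other is |f y| <= 2 |f u| on the ball; [c2]
   collects the losses from the cells and the annuli. *)
exists (4 * C * c2 `^ q^-1) => n f g n0 pf fg.
have rho0 : 0 < delta / n%:R by rewrite divr_gt0 ?ltr0n.
have v0 : 0 < wmass X varpi Om by rewrite varpi_unit.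
have [z [Oz OB]] := countable_cover domX varpi_doubling v0 rho0.
pose phi x := `|f x| `^ q * w x.
have phi0 x : Om x -> 0 <= phi x by move=> Ox; rewrite mulr_ge0 ?powR_ge0 ?w0.
have mphi : measurable_fun Om phi.
  by apply: measurable_funM => //; exact: measurable_powR_norm pf.
have nr0 : 0 <= n%:R `^ r :> R by exact: powR_ge0.
pose A := 4 * C * n%:R `^ r; have A0 : 0 <= A by rewrite mulr_ge0// mulr_ge0// ltW.
pose K := A `^ q * c1; have K0 : 0 <= K by rewrite mulr_ge0 ?powR_ge0// ltW.
have pointwise x : Om x -> ((`|g x| `^ q * w x)%:E <= (K * w x)%:E *
    \sum_(k <oo) ((sdist X n (z k) x ^+ s.+1)^-1)%:E * cell_average X w delta n z phi k)%E.
  move=> Ox; have [y [Oy fy fball]] := near n f x n0 pf Ox.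
  have Wy := Wball _ _ Oy rho0; set V := W _ in Wy.
  have T1 : 1 <= sdist X n x y ^+ s.+1 by rewrite exprn_ege1// sdist_ge1.
  set T := sdist X n x y ^+ s.+1 in T1 fy; have T0 : 0 < T by lra.
  have gx : `|g x| <= 2 * C * n%:R `^ r * (`|f y| * T^-1).
    rewrite (_ : 2 * C * _ * _ = C * (n%:R `^ r * (2 * `|f y| / T))); last by ring.
    by apply: (hC n f g x) => //; rewrite divr_ge0 ?mulr_ge0// ltW.
  have gxq : `|g x| `^ q <= (2 * C * n%:R `^ r) `^ q * `|f y| `^ q * T^-1.
    have cn : 0 <= 2 * C * n%:R `^ r by rewrite mulr_ge0// mulr_ge0// ltW.
    have fT : 0 <= `|f y| * T^-1 by rewrite mulr_ge0// invr_ge0 ltW.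
    apply: (@le_trans _ _ ((2 * C * n%:R `^ r * (`|f y| * T^-1)) `^ q)).
      by apply: ge0_ler_powR; rewrite ?nnegrE//; [exact: ltW|exact: mulr_ge0].
    have ti : 0 <= T^-1 by rewrite invr_ge0 ltW.
    rewrite (powRM _ cn fT) (powRM _ (normr_ge0 _) ti) mulrA ler_wpM2l ?mulr_ge0 ?powR_ge0//.
    exact: powR_ge_inv.
  have avgf : ((`|f y| `^ q * V)%:E <=
      (2 `^ q)%:E * \int[m]_(u in dball X y (delta / n%:R)) (phi u)%:E)%E.
    have mB := mball Oy rho0.
    have BO := @dball_Om _ _ X y (delta / n%:R).
    have mwB : measurable_fun (dball X y (delta / n%:R)) (EFin \o w).
      by apply/measurable_EFinP; apply: measurable_funS mw.
    have mphiB : measurable_fun (dball X y (delta / n%:R)) (EFin \o phi).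
      by apply/measurable_EFinP; apply: measurable_funS mphi.
    rewrite EFinM (wmassE domX w_weight mB BO) -!ge0_integralZl_EFin ?powR_ge0//; last 2 first.
    - by move=> u /BO Ou; rewrite lee_fin phi0.
    - by move=> u /BO Ou; rewrite lee_fin w0.
    apply: ge0_le_integral_nonmeasurable => u Bu; rewrite -EFinM lee_fin.
      by rewrite mulr_ge0 ?powR_ge0 ?w0//; exact: BO.
    rewrite mulrA ler_wpM2r ?w0//; first exact: BO.
    rewrite -powRM//; apply: ge0_ler_powR; rewrite ?nnegrE ?mulr_ge0 ?fball//.
    exact: ltW.
  have Bsum := ball_integral_le domX w_weight Wball growth delta01 n0 Oz OB phi0 mphi Ox Oy.
  set S := (\sum_(k <oo) _)%E in Bsum *.
  have S0 : (0 <= S)%E.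
    apply: nneseries_ge0 => k _ _; apply: mule_ge0.
      by rewrite lee_fin invr_ge0 exprn_ge0// ltW// sdist_gt0.
    exact: cell_average_ge0.
  have fS : ((`|f y| `^ q * V)%:E <= (2 `^ q * (c1 * T * V))%:E * S)%E.
    rewrite [X in (_ <= X * _)%E]EFinM -muleA; apply: le_trans avgf _.
    by apply: lee_wpmul2l => //; rewrite lee_fin powR_ge0.
  (* Multiplying [fS] by this factor cancels T and V, the last quantities that depend on y. *)
  pose kap := (2 * C * n%:R `^ r) `^ q / T / V * w x.
  have kap0 : 0 <= kap.
    by rewrite mulr_ge0 ?w0// divr_ge0 ?(ltW Wy)// divr_ge0 ?(ltW T0)// powR_ge0.
  apply: (@le_trans _ _ (kap%:E * (`|f y| `^ q * V)%:E)%E).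
    rewrite -EFinM lee_fin /kap.
    rewrite (_ : _ * (_ * V) = (2 * C * n%:R `^ r) `^ q * `|f y| `^ q * T^-1 * w x); last first.
      by field; rewrite !gt_eqF.
    by rewrite ler_wpM2r ?w0.
  apply: le_trans (lee_wpmul2l _ fS) _; first by rewrite lee_fin.
  rewrite muleA -EFinM le_eqVlt; apply/orP; left; apply/eqP; congr (_%:E * _)%E.
  rewrite /K /A (_ : 4 * C * _ = 2 * (2 * C * n%:R `^ r)); last by ring.
  rewrite powRM ?mulr_ge0 ?(ltW C0)// /kap; field.
  by rewrite !gt_eqF.
have main : (\int[m]_(x in Om) (`|g x| `^ q * w x)%:E <=
    (A `^ q * c2)%:E * \int[m]_(x in Om) (phi x)%:E)%E.
  apply: le_trans (@ge0_le_integral_nonmeasurable _ _ _ m Om _ _ _ pointwise) _.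
    by move=> x Ox; rewrite lee_fin mulr_ge0 ?powR_ge0 ?w0.
  rewrite (_ : A `^ q * c2 = K * 2 ^+ (2 * s.+1)); last by rewrite /K /c2 mulrA.
  exact: (integral_cell_average_le domX w_weight Wball growth delta01 n0 Oz OB phi0 mphi K0).
have qi : 0 <= q^-1 by rewrite invr_ge0 ltW.
rewrite /wnorm (_ : 4 * C * c2 `^ q^-1 * n%:R `^ r = (A `^ q * c2) `^ q^-1); last first.
  rewrite powRM ?powR_ge0 ?(ltW c20)// -powRrM mulfV ?gt_eqF// powRr1// /A; ring.
rewrite -poweR_EFin -poweRM//; last 2 first.
- by rewrite lee_fin mulr_ge0 ?powR_ge0// ltW.
- by apply: integral_ge0 => x Ox; rewrite lee_fin phi0.
apply: gt0_ler_poweR => //; rewrite in_itv/= leey andbT.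
  by apply: integral_ge0 => x Ox; rewrite lee_fin mulr_ge0 ?powR_ge0 ?w0.
apply: mule_ge0; first by rewrite lee_fin mulr_ge0 ?powR_ge0// ltW.
by apply: integral_ge0 => x Ox; rewrite lee_fin phi0.
Qed.

End Bernstein.

Theorem theorem3p17 (R : realType) (d : nat) (X : mdomain R d)
    (varpi : euclid R d -> R) (mu : {poly R})
    (P : nat -> euclid R d -> euclid R d -> R)
    (d_gt0 : (0 < d)%N)
    (domX : is_domain X)
    (varpi_doubling : doubling_weight X varpi)
    (varpi_unit : wmass X varpi (Omega X) = 1)
    (P_kernel : reproducing_kernel X varpi P)
    (varpi_eigen : eigen_operator X varpi mu)
    (P_addition : addition_formula X P)
    (H1 : Assertion1 X varpi P)
    (H2 : Assertion2 X varpi P)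
    (H3 : Assertion3 X varpi)
    (H4 : Assertion4 X)
    (H5 : Assertion5 X varpi mu P)
    (w : euclid R d -> R) (w_doubling : doubling_weight X w)
    (r : R) (r_gt0 : 0 < r) (p : \bar R) (p_ge1 : (1 <= p)%E) :
  exists c : R, forall (n : nat) (f g : euclid R d -> R),
    (0 < n)%N -> poly_on X n f -> is_fractional_power X varpi mu r f g ->
    (wnorm X w p g <= (c * n%:R `^ r)%:E * wnorm X w p f)%E.
Proof.
have [cOm _] := H4.
case: p p_ge1 => [q| |//] hq.
  exact: (bernstein_integral domX cOm varpi_doubling varpi_unit P_kernel H2 H3 H5).
exact: (bernstein_uniform domX cOm varpi_doubling varpi_unit P_kernel H3 H5).
Qed.
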